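(* Let $\mathbf{A}\in\mathbb{R}^{n\times d}$, $b\in\mathbb{R}^d$, $c\in\mathbb{R}^n$, and let $\epsilon\in(0,\|\mathbf{A}\|_{1\to1})$. The algorithm BoxSimplex$(\mathbf{A},b,c,\epsilon)$, written out in full in the context, deterministically computes an $\epsilon$-approximate saddle point of the box-simplex game $$\min_{x\in[-1,1]^n}\ \max_{y\in\Delta^d}\ x^\top\mathbf{A}y-b^\top y+c^\top x$$ in time $$O\left(\mathrm{nnz}(\mathbf{A})\cdot\frac{\|\mathbf{A}\|_{1\to1}\log d}{\epsilon}\right).$$ This assumes direct access to the entries of $\mathbf{A}$. More generally, $\mathrm{nnz}(\mathbf{A})$ may be replaced by $\max\left(\mathcal{T}_{\mathrm{mv}}(\mathbf{A}),\mathcal{T}_{\mathrm{mv}}(\mathbf{A}^\top),\mathcal{T}_{\mathrm{mv}}(|\mathbf{A}|),\mathcal{T}_{\mathrm{mv}}(|\mathbf{A}^\top|)\right)$.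
   Context: Notation. $\Delta^d=\{y\in\mathbb{R}^d_{\ge0}:\|y\|_1=1\}$. $\|\mathbf{A}\|_{1\to1}=\sup_{\|v\|_1=1}\|\mathbf{A}v\|_1$ is the largest $\ell_1$ norm of a column of $\mathbf{A}$. $\mathrm{nnz}(\mathbf{A})$ is the number of nonzero entries of $\mathbf{A}$. $\mathcal{T}_{\mathrm{mv}}(\mathbf{M})$ is the time needed to multiply a vector by $\mathbf{M}$. $|\mathbf{A}|$ is the entrywise absolute value. For $f(x,y)=x^\top\mathbf{A}y-b^\top y+c^\top x$, a point $(x,y)\in[-1,1]^n\times\Delta^d$ is an $\epsilon$-approximate saddle point if $\max_{y'\in\Delta^d}f(x,y')-\min_{x'\in[-1,1]^n}f(x',y)\le\epsilon$. In the algorithm, squares, logarithms, exponentials and quotients of vectors are entrywise, and $u\circ v$ is the entrywise product. $\Pi_{\mathcal X}(v)$ truncates each entry of $v\in\mathbb{R}^n$ to $[-1,1]$. $\Pi_{\mathcal Y}(v)=v/\|v\|_1$ for $v\in\mathbb{R}^d_{\ge0}$. $\mathrm{diag}(x)$ is the diagonal matrix with diagonal $x$. $\mathbf 0_k$ and $\mathbf 1_k$ are the all-zeros and all-ones vectors in $\mathbb{R}^k$. Algorithm BoxSimplex$(\mathbf{A},b,c,\epsilon)$. Let $L=\|\mathbf{A}\|_{1\to1}$. Initialize $x_0=\mathbf 0_n$, $y_0=\bar y_0=\frac1d\mathbf 1_d$, $\hat x=\mathbf 0_n$, $\hat y=\mathbf 0_d$, $T=\left\lceil\frac{6(8\log d+1)L}{\epsilon}\right\rceil$.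 Rescale $\mathbf{A}\gets\frac1L\mathbf{A}$, $b\gets\frac1Lb$, $c\gets\frac1Lc$. For $t=0,1,\dots,T-1$ do the following. (Gradient step, with $\beta=2$.) 1. $(g^{\mathsf x}_t,g^{\mathsf y}_t)\gets\frac13(\mathbf{A}y_t+c,\ b-\mathbf{A}^\top x_t)$. 2. $x^\star_t\gets\Pi_{\mathcal X}\left(-\frac{g^{\mathsf x}_t-2\,\mathrm{diag}(x_t)|\mathbf{A}|y_t}{2|\mathbf{A}|y_t}\right)$. 3. $y'_t\gets\Pi_{\mathcal Y}\left(y_t\circ\exp\left(-\frac1\beta\left(g^{\mathsf y}_t+|\mathbf{A}|^\top(x^\star_t)^2-|\mathbf{A}|^\top x_t^2\right)\right)\right)$. 4. $x'_t\gets\Pi_{\mathcal X}\left(-\frac{g^{\mathsf x}_t-2\,\mathrm{diag}(x_t)|\mathbf{A}|y_t}{2|\mathbf{A}|y'_t}\right)$. 5. $(\hat x,\hat y)\gets(\hat x,\hat y)+\frac1T(x'_t,y'_t)$. (Extragradient step, with $\alpha=\beta=4$.) 6. $(g^{\mathsf x}_t,g^{\mathsf y}_t)\gets\frac16(\mathbf{A}y'_t+c,\ b-\mathbf{A}^\top x'_t)$. 7. $\bar x^\star_t\gets\Pi_{\mathcal X}\left(-\frac{g^{\mathsf x}_t-2\,\mathrm{diag}(x_t)|\mathbf{A}|y_t}{2|\mathbf{A}|\bar y_t}\right)$. 8. $y_{t+1}\gets\Pi_{\mathcal Y}\left(\bar y_t\circ\exp\left(-\frac1\beta\left(g^{\mathsf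 y}_t+|\mathbf{A}|^\top(\bar x^\star_t)^2+\alpha\log\bar y_t-|\mathbf{A}|^\top x_t^2-\alpha\log y_t\right)\right)\right)$. 9. $x_{t+1}\gets\Pi_{\mathcal X}\left(-\frac{g^{\mathsf x}_t-2\,\mathrm{diag}(x_t)|\mathbf{A}|y_t}{2|\mathbf{A}|y_{t+1}}\right)$. 10. $\bar y_{t+1}\gets\Pi_{\mathcal Y}\left(\bar y_t\circ\exp\left(-\frac1\beta\left(g^{\mathsf y}_t+|\mathbf{A}|^\top(x_{t+1})^2+\alpha\log y_{t+1}-|\mathbf{A}|^\top x_t^2-\alpha\log y_t\right)\right)\right)$. Return $(\hat x,\hat y)$. Without loss of generality $\mathrm{nnz}(\mathbf{A})\ge\max(n,d)$ (otherwise rows or columns are dropped appropriately). A quotient with zero denominator (arising only from a zero row of $\mathbf{A}$) is read as $\pm\infty$ according to the sign of the numerator (and as $0$ if the numerator is $0$) before truncation. The factor $\log d$ is understood for $d\ge2$. *)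

(* Defs.v *)
From HB Require Import structures.
From mathcomp Require Import all_boot all_order all_algebra.
From mathcomp Require Import all_classical all_reals all_analysis.

Set Implicit Arguments.
Unset Strict Implicit.
Unset Printing Implicit Defensive.

Import Order.TTheory GRing.Theory Num.Theory.

Local Open Scope classical_set_scope.
Local Open Scope ring_scope.

Section Game.
Variable R : realType.

Definition l1norm (k : nat) (v : 'cV[R]_k) : R := \sum_(i < k) `|v i 0|.

Definition box (n : nat) : set 'cV[R]_n :=
  [set x : 'cV[R]_n | forall i, -1 <= x i 0 <= 1].

Definition simplex (d : nat) : set 'cV[R]_d :=
  [set y : 'cV[R]_d | (forall j, 0 <= y j 0) /\ l1norm y = 1].

Definition opnorm11 (n d : nat) (A : 'M[R]_(n, d)) : R :=
  sup [set l1norm (A *m v) | v in [set v : 'cV[R]_d | l1norm v = 1]].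

Definition nnz (n d : nat) (A : 'M[R]_(n, d)) : nat :=
  #|[set ij : 'I_n * 'I_d | A ij.1 ij.2 != 0]%SET|.

Definition absmx (n d : nat) (A : 'M[R]_(n, d)) : 'M[R]_(n, d) :=
  map_mx Num.norm A.

Definition payoff (n d : nat) (A : 'M[R]_(n, d)) (b : 'cV[R]_d) (c : 'cV[R]_n)
    (x : 'cV[R]_n) (y : 'cV[R]_d) : R :=
  (x^T *m A *m y) 0 0 - (b^T *m y) 0 0 + (c^T *m x) 0 0.

(* The extrema are over nonempty compact sets, hence attained: [sup] and [inf]
   are the max and the min. *)
Definition approx_saddle (n d : nat) (A : 'M[R]_(n, d)) (b : 'cV[R]_d)
    (c : 'cV[R]_n) (eps : R) (x : 'cV[R]_n) (y : 'cV[R]_d) : Prop :=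
  [/\ box x, simplex y &
      sup [set payoff A b c x y' | y' in @simplex d] -
      inf [set payoff A b c x' y | x' in @box n] <= eps].

Definition sqmx (k : nat) (v : 'cV[R]_k) : 'cV[R]_k :=
  map_mx (fun a => a ^+ 2) v.
Definition lnmx (k : nat) (v : 'cV[R]_k) : 'cV[R]_k := map_mx (@ln R) v.
Definition expmx (k : nat) (v : 'cV[R]_k) : 'cV[R]_k := map_mx expR v.
Definition hadamard (k : nat) (u v : 'cV[R]_k) : 'cV[R]_k :=
  \col_i (u i 0 * v i 0).

(* The quotient p / q, read in the extended reals when q = 0. *)
Definition equot (p q : R) : \bar R :=
  if q == 0 then
    if p == 0 then 0%:E else if 0 < p then +oo%E else -oo%E
  else (p / q)%:E.

Definition truncate (a : \bar R) : R := fine (maxe (-1)%:E (mine 1%:E a)).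

(* Pi_X (- p / q), with entrywise quotient. *)
Definition projX_quot (k : nat) (p q : 'cV[R]_k) : 'cV[R]_k :=
  \col_i truncate (oppe (equot (p i 0) (q i 0))).

Definition projY (k : nat) (v : 'cV[R]_k) : 'cV[R]_k := (l1norm v)^-1 *: v.

Record iterate (n d : nat) := Iterate {
  it_x : 'cV[R]_n;
  it_y : 'cV[R]_d;
  it_ybar : 'cV[R]_d;
  it_xhat : 'cV[R]_n;
  it_yhat : 'cV[R]_d }.

Definition bs_init (n d : nat) : iterate n d :=
  {| it_x := 0;
     it_y := const_mx (d%:R^-1);
     it_ybar := const_mx (d%:R^-1);
     it_xhat := 0;
     it_yhat := 0 |}.

(* One pass of the loop, a gradient step (up to yhat1) followed by an
   extragradient step; A, b, c are already rescaled. *)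
Definition bs_step (n d : nat) (A : 'M[R]_(n, d)) (b : 'cV[R]_d)
    (c : 'cV[R]_n) (T : nat) (z : iterate n d) : iterate n d :=
  let: Iterate x y ybar xhat yhat := z in
  let Abs := absmx A in
  let beta : R := 2 in
  let gx := 3^-1 *: (A *m y + c) in
  let gy := 3^-1 *: (b - A^T *m x) in
  let num := gx - 2 *: (diag_mx x^T *m (Abs *m y)) in
  let xstar := projX_quot num (2 *: (Abs *m y)) in
  let y' := projY (hadamard y (expmx (- beta^-1 *:
              (gy + Abs^T *m sqmx xstar - Abs^T *m sqmx x)))) in
  let x' := projX_quot num (2 *: (Abs *m y')) in
  let xhat1 := xhat + T%:R^-1 *: x' in
  let yhat1 := yhat + T%:R^-1 *: y' in
  let alpha : R := 4 in
  let beta : R := 4 in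
  let gx := 6^-1 *: (A *m y' + c) in
  let gy := 6^-1 *: (b - A^T *m x') in
  let num := gx - 2 *: (diag_mx x^T *m (Abs *m y)) in
  let xbstar := projX_quot num (2 *: (Abs *m ybar)) in
  let y1 := projY (hadamard ybar (expmx (- beta^-1 *:
              (gy + Abs^T *m sqmx xbstar + alpha *: lnmx ybar
               - Abs^T *m sqmx x - alpha *: lnmx y)))) in
  let x1 := projX_quot num (2 *: (Abs *m y1)) in
  let ybar1 := projY (hadamard ybar (expmx (- beta^-1 *:
              (gy + Abs^T *m sqmx x1 + alpha *: lnmx y1
               - Abs^T *m sqmx x - alpha *: lnmx y)))) in
  Iterate x1 y1 ybar1 xhat1 yhat1.

Definition bs_T (n d : nat) (A : 'M[R]_(n, d)) (eps : R) : nat :=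
  `|Num.ceil (6 * (8 * ln d%:R + 1) * opnorm11 A / eps)|%N.

Definition box_simplex (n d : nat) (A : 'M[R]_(n, d)) (b : 'cV[R]_d)
    (c : 'cV[R]_n) (eps : R) : 'cV[R]_n * 'cV[R]_d :=
  let L := opnorm11 A in
  let T := bs_T A eps in
  let z := iter T (bs_step (L^-1 *: A) (L^-1 *: b) (L^-1 *: c) T)
                (bs_init n d) in
  (it_xhat z, it_yhat z).

End Game.

(* A real RAM: a structured program works on index registers and index arrays
(natural numbers) and on real registers and real arrays. Every node of an
expression and every executed command or test costs one time unit; [exp] and
[ln] are unit-cost operations. There is no rounding operation and no conversion
between indices and reals. Programs do not depend on the reals [R] they are run
on: their only numerical constants are natural numbers.

[O] is a type of names of additional matrix-vector multiplication subroutines;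
a program of type [cmd void] has none. *)

Inductive iexp : Type :=
| IConst of nat
| IReg of nat
| IGet of nat & iexp            (* array name, position *)
| IAdd of iexp & iexp.

Inductive rexp : Type :=
| RConst of nat
| RReg of nat
| RGet of nat & iexp            (* array name, position *)
| RAdd of rexp & rexp
| RSub of rexp & rexp
| RMul of rexp & rexp
| RDiv of rexp & rexp
| RExp of rexp
| RLn of rexp.

Inductive bexp : Type :=
| ILt of iexp & iexp
| RLt of rexp & rexp.

Inductive cmd (O : Type) : Type :=
| Skip
| ISet of nat & iexp            (* register := value *)
| IPut of nat & iexp & iexp     (* array[position] := value *)
| RSet of nat & rexp
| RPut of nat & iexp & rexp
| Seq of cmd O & cmd O
| If of bexp & cmd O & cmd O
| While of bexp & cmd O
| MatVec of O & nat & nat.      (* subroutine, source array, target array *)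

Fixpoint icost (e : iexp) : nat :=
  match e with
  | IConst _ | IReg _ => 1
  | IGet _ e1 => (icost e1).+1
  | IAdd e1 e2 => (icost e1 + icost e2).+1
  end.

Fixpoint rcost (e : rexp) : nat :=
  match e with
  | RConst _ | RReg _ => 1
  | RGet _ e1 => (icost e1).+1
  | RAdd e1 e2 | RSub e1 e2 | RMul e1 e2 | RDiv e1 e2 =>
      (rcost e1 + rcost e2).+1
  | RExp e1 | RLn e1 => (rcost e1).+1
  end.

Definition bcost (e : bexp) : nat :=
  match e with
  | ILt e1 e2 => (icost e1 + icost e2).+1
  | RLt e1 e2 => (rcost e1 + rcost e2).+1
  end.

Definition upd (T : Type) (f : nat -> T) (k : nat) (v : T) : nat -> T :=
  fun j => if j == k then v else f j.

Section Machine.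
Variable R : realType.

Record state := State {
  ireg : nat -> nat;
  iarr : nat -> nat -> nat;     (* array name, position *)
  rreg : nat -> R;
  rarr : nat -> nat -> R }.

Fixpoint ieval (s : state) (e : iexp) : nat :=
  match e with
  | IConst k => k
  | IReg r => ireg s r
  | IGet a e1 => iarr s a (ieval s e1)
  | IAdd e1 e2 => (ieval s e1 + ieval s e2)%N
  end.

Fixpoint reval (s : state) (e : rexp) : R :=
  match e with
  | RConst k => k%:R
  | RReg r => rreg s r
  | RGet a e1 => rarr s a (ieval s e1)
  | RAdd e1 e2 => reval s e1 + reval s e2
  | RSub e1 e2 => reval s e1 - reval s e2
  | RMul e1 e2 => reval s e1 * reval s e2
  | RDiv e1 e2 => reval s e1 / reval s e2
  | RExp e1 => expR (reval s e1)
  | RLn e1 => ln (reval s e1)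
  end.

Definition beval (s : state) (e : bexp) : bool :=
  match e with
  | ILt e1 e2 => (ieval s e1 < ieval s e2)%N
  | RLt e1 e2 => reval s e1 < reval s e2
  end.

Definition set_ireg (s : state) (r v : nat) : state :=
  State (upd (ireg s) r v) (iarr s) (rreg s) (rarr s).
Definition set_iarr (s : state) (a i v : nat) : state :=
  State (ireg s) (upd (iarr s) a (upd (iarr s a) i v)) (rreg s) (rarr s).
Definition set_rreg (s : state) (r : nat) (v : R) : state :=
  State (ireg s) (iarr s) (upd (rreg s) r v) (rarr s).
Definition set_rarr (s : state) (a i : nat) (v : R) : state :=
  State (ireg s) (iarr s) (rreg s) (upd (rarr s) a (upd (rarr s a) i v)).

(* A subroutine multiplying vectors by the matrix [mv_mx] in time [mv_time]. *)
Record mv_subroutine := MvSubroutine {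
  mv_rows : nat;
  mv_cols : nat;
  mv_mx : 'M[R]_(mv_rows, mv_cols);
  mv_time : nat }.

Definition store_vec (s : state) (a k : nat) (v : 'cV[R]_k) : state :=
  State (ireg s) (iarr s) (rreg s)
    (upd (rarr s) a
       (fun i => if insub i is Some i' then v i' 0 else rarr s a i)).

Definition run_matvec (m : mv_subroutine) (src dst : nat) (s : state) : state :=
  store_vec s dst (mv_mx m *m \col_(j < mv_cols m) rarr s src j).

(* [exec sub p s t s']: started in state s, the program p halts after time t
   in state s'. *)
Inductive exec (O : Type) (sub : O -> mv_subroutine) :
    cmd O -> state -> nat -> state -> Prop :=
| ExecSkip s :
    exec sub (Skip O) s 1 s
| ExecISet r e s :
    exec sub (ISet O r e) s (icost e).+1 (set_ireg s r (ieval s e))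
| ExecIPut a i e s :
    exec sub (IPut O a i e) s (icost i + icost e).+1
      (set_iarr s a (ieval s i) (ieval s e))
| ExecRSet r e s :
    exec sub (RSet O r e) s (rcost e).+1 (set_rreg s r (reval s e))
| ExecRPut a i e s :
    exec sub (RPut O a i e) s (icost i + rcost e).+1
      (set_rarr s a (ieval s i) (reval s e))
| ExecSeq p q s s1 s2 t1 t2 :
    exec sub p s t1 s1 -> exec sub q s1 t2 s2 ->
    exec sub (Seq p q) s (t1 + t2) s2
| ExecIfTrue e p q s s1 t :
    beval s e -> exec sub p s t s1 ->
    exec sub (If e p q) s ((bcost e).+1 + t) s1
| ExecIfFalse e p q s s1 t :
    ~~ beval s e -> exec sub q s t s1 ->
    exec sub (If e p q) s ((bcost e).+1 + t) s1
| ExecWhileTrue e p s s1 s2 t1 t2 :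
    beval s e -> exec sub p s t1 s1 -> exec sub (While e p) s1 t2 s2 ->
    exec sub (While e p) s ((bcost e).+1 + t1 + t2) s2
| ExecWhileFalse e p s :
    ~~ beval s e ->
    exec sub (While e p) s (bcost e).+1 s
| ExecMatVec o src dst s :
    exec sub (MatVec o src dst) s (mv_time (sub o)).+1
      (run_matvec (sub o) src dst s).

Lemma exec_deterministic (O : Type) (sub : O -> mv_subroutine) p s t1 s1 t2 s2 :
  exec sub p s t1 s1 -> exec sub p s t2 s2 -> t1 = t2 /\ s1 = s2.
Proof.
move=> H; elim: H t2 s2 => {p s t1 s1};
  intros; match goal with E : exec _ _ _ ?t ?s |- _ /\ _ = ?s =>
    inversion E; subst; clear E end;
  repeat match goal with
  | IH : forall t s, exec _ ?p ?s0 t s -> _, E : exec _ ?p ?s0 _ _ |- _ =>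
      case: (IH _ _ E) => ? ?; subst; clear E
  | b : is_true (beval ?s ?e), nb : is_true (~~ beval ?s ?e) |- _ =>
      by rewrite b in nb
  end; by [].
Qed.

Definition holds_vec (s : state) (a k : nat) (v : 'cV[R]_k) : Prop :=
  forall i : 'I_k, rarr s a i = v i 0.

(* Everything not mentioned, in particular the working memory and the array
   cells beyond the stated lengths, is arbitrary. *)
Definition holds_params (n d : nat) (s : state) (b : 'cV[R]_d) (c : 'cV[R]_n)
    (eps : R) : Prop :=
  [/\ ireg s 0 = n, ireg s 1 = d, rreg s 0 = eps,
      holds_vec s 0 b & holds_vec s 1 c].

(* The nonzero entries of A as a list of triplets (row, column, value), in any
   order. *)
Definition holds_entries (n d : nat) (s : state) (A : 'M[R]_(n, d)) : Prop :=
  exists es : seq ('I_n * 'I_d),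
    [/\ uniq es,
        forall ij, (ij \in es) = (A ij.1 ij.2 != 0),
        ireg s 2 = size es &
        forall k : 'I_(size es),
          let ij := tnth (in_tuple es) k in
          [/\ iarr s 0 k = ij.1, iarr s 1 k = ij.2 &
              rarr s 2 k = A ij.1 ij.2]].

Definition holds_output (n d : nat) (s : state) (xy : 'cV[R]_n * 'cV[R]_d) :
    Prop :=
  holds_vec s 3 xy.1 /\ holds_vec s 4 xy.2.

Definition no_subroutine (o : void) : mv_subroutine := match o with end.

End Machine.

Inductive mv_name : Type := MvA | MvAT | MvAbs | MvAbsT.

Definition game_subroutines (R : realType) (n d : nat) (A : 'M[R]_(n, d))
    (Tmv : mv_name -> nat) (o : mv_name) : mv_subroutine R :=
  match o with
  | MvA => MvSubroutine A (Tmv MvA)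
  | MvAT => MvSubroutine A^T (Tmv MvAT)
  | MvAbs => MvSubroutine (absmx A) (Tmv MvAbs)
  | MvAbsT => MvSubroutine (absmx A^T) (Tmv MvAbsT)
  end.

Definition max_Tmv (Tmv : mv_name -> nat) : nat :=
  maxn (maxn (Tmv MvA) (Tmv MvAT)) (maxn (Tmv MvAbs) (Tmv MvAbsT)).

(* Main.v *)
Require Import Defs.
From mathcomp Require Import all_boot all_order all_algebra.
From mathcomp Require Import all_classical all_reals all_analysis.
From mathcomp Require Import ring lra zify.

Set Implicit Arguments.
Unset Strict Implicit.
Unset Printing Implicit Defensive.

Import Order.TTheory GRing.Theory Num.Theory.
Local Open Scope ring_scope.

(** Correctness. After rescaling, the columns of |A| have l1 norm at most 1. The
algorithm is an extragradient method on z = (x, y) with the regularizer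
r(x, y) = sum_ij |A_ij| y_j x_i^2 + alpha sum_j y_j ln y_j. Let V_z(w) be its
Bregman divergence and g the gradient field of the game, which is affine with an
antisymmetric linear part. Extragradient methods need the local error
<g(z') - g(z), z' - w> to be paid by divergences. For this regularizer they do
pay, because the error is a sum over the entries of A of areas of triangles in
the plane ([area_convexity]), and each area is bounded by divergences between
its vertices ([area_entry]).

The proximal steps of r have no closed form, and the algorithm replaces them by
one alternation: best response in x, entropic step in y, best response in x.
This suffices because the best response at p is nearly optimal at q, up to
2 KL(q|p) ([self_bounding]). In the gradient step the loss doubles the entropy
coefficient from 2 to 4 ([gradient_step]). In the extragradient step the entropic
updates of y are taken from a second sequence ybar, itself updated with the
gradient at the new point, and the loss is absorbed by the relative entropy
between consecutive ybar ([extragradient_step]). Together, one pass lowers the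
potential V_z(w) + 4 KL(q|ybar) by a sixth of the duality gap of z' against
w = (u, q) ([iteration_progress]). The potential starts at most at 8 ln d + 1 and stays
nonnegative, so averaging the z' over T passes leaves a gap of at most
6 (8 ln d + 1) / T on rescaled data ([final_gap]), which is at most eps after
scaling back.

Running time. The program is written in a small language of whole-vector
instructions, with a denotation on vectors and a compilation to loops whose cost
is a constant multiple of a common bound M on n, d and the cost of one product
([simulation]). The denotation of the loop body is one pass of the algorithm
([denote_loop_body]), so the total cost is a constant times T M, and T is at most
62 L ln d / eps. The two forms of access to A differ only in the command that
performs a product ([entries_multiplies] and [call_multiplies]). *)

(** * Scalar inequalities *)

Section Scalar.
Variable R : realType.
Implicit Types a b p q w x u m k h P S D E : R.

(** The terms - b + a make this nonnegative for unnormalized arguments; at b = 0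
the product with ln 0 vanishes, as it should. *)
Definition kl b a : R := b * (ln b - ln a) - b + a.

Lemma ge0_derive_le (f f' : R -> R) a b :
  (forall t : R, 0 < t -> is_derive t (1 : R) f (f' t)) ->
  (forall t : R, 0 < t -> 0 <= f' t) -> 0 < a -> a <= b -> f a <= f b.
Proof.
move=> df f'0 a0 ab.
apply: (@ger0_derive1_le_cc _ f a b) => //; rewrite ?in_itv /= ?lexx ?ab //.
- move=> t; rewrite in_itv /= => /andP[ta t1].
  by have [] := df t (lt_trans a0 ta).
- move=> t; rewrite in_itv /= => /andP[ta t1].
  have t0 : 0 < t by apply: lt_trans ta.
  have := df t t0 => ?; rewrite derive1E derive_val; exact: f'0.
- apply: derivable_within_continuous => t.
  rewrite in_itv /= => /andP[ta t1].
  by have [] := df t (lt_le_trans a0 ta).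
Qed.

Lemma neg_ln_ge a : 0 < a <= 1 -> 1 - a + (1 - a) ^+ 2 / 2 <= - ln a.
Proof.
move=> /andP[a0 a1]; pose f (t : R) := t ^+ 2 * 2^-1 - t * 2 + ln t.
suff : f a <= f 1 by rewrite /f ln1; lra.
apply: (@ge0_derive_le f (fun t => (t - 1) ^+ 2 / t)) => // t t0.
  have := is_derive1_ln t0 => ?; apply: is_derive_eq.
  rewrite /GRing.scale /=; field; lra.
by rewrite divr_ge0 ?sqr_ge0 // ltW.
Qed.

Lemma ln_ge_half a : 0 < a <= 1 -> (a - a^-1) / 2 <= ln a.
Proof.
move=> /andP[a0 a1]; pose f (t : R) := t * 2^-1 - t^-1 * 2^-1 - ln t.
suff : f a <= f 1 by rewrite /f ln1; lra.
apply: (@ge0_derive_le f (fun t => (t - 1) ^+ 2 / (2 * t ^+ 2))) => // t t0.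
  have t1 : t != 0 by rewrite gt_eqF.
  have := @is_deriveV R id t 1 1 t1 (is_derive_id _ _) => ?.
  have := is_derive1_ln t0 => ?; apply: is_derive_eq.
  rewrite /GRing.scale /=; field; lra.
by rewrite divr_ge0 ?sqr_ge0 // mulr_ge0 ?sqr_ge0.
Qed.

(** Taylor expansion at second order: the second derivative of b ln b is 1 / b,
which is at least 1 / max on the segment. The two sides of a use the two bounds
of ln above. *)
Lemma kl_ge b a : 0 <= b -> 0 < a -> (b - a) ^+ 2 / Num.max b a <= 2 * kl b a.
Proof.
move=> b0 a0; rewrite /kl; case: (ltgtP b 0) b0 => // [bp _|-> _].
  have [ab|ba] := leP b a.
    have t01 : 0 < b / a <= 1 by rewrite divr_gt0 //= ler_pdivrMr // mul1r.
    have := ln_ge_half t01; rewrite ln_div ?posrE // => l.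
    have e : (b - a) ^+ 2 / a = b * (b / a - (b / a)^-1) - 2 * b + 2 * a.
      by field; lra.
    have := ler_wpM2l (ltW bp) l; rewrite e; lra.
  have t01 : 0 < a / b <= 1 by rewrite divr_gt0 //= ler_pdivrMr // mul1r ltW.
  have := neg_ln_ge t01; rewrite ln_div ?posrE // => l.
  have e : (b - a) ^+ 2 / b = 2 * b * (1 - a / b + (1 - a / b) ^+ 2 / 2) - 2 * b + 2 * a.
    by field; lra.
  have := ler_wpM2l (ltW bp) l; rewrite e; lra.
rewrite mul0r sub0r oppr0 add0r sqrrN (max_idPr (ltW a0)) expr2 mulfK ?gt_eqF //; lra.
Qed.

Lemma kl_ge0 b a : 0 <= b -> 0 < a -> 0 <= kl b a.
Proof.
move=> b0 a0; have := kl_ge b0 a0.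
have : 0 <= (b - a) ^+ 2 / Num.max b a.
  by rewrite divr_ge0 ?sqr_ge0 // le_max b0.
lra.
Qed.

(** Bregman divergence of the function (x, p) |-> p x^2, from (x, p) to
(x + dl, w): what one entry of the matrix contributes to the regularizer. *)
Definition entry_bregman p w x dl : R := w * dl ^+ 2 + 2 * x * dl * (w - p).

(** The function p x^2 is not jointly convex, and the divergence can be negative.
Since x and x + dl lie in [-1, 1], it is at least
max dl^2 - 2 |dl| |w - p|, and (w - p)^2 / max completes the square. *)
Lemma entry_bregman_ge p w x dl : 0 < p -> 0 <= w -> -1 <= x <= 1 -> -1 <= x + dl <= 1 ->
  Num.max w p * (`|dl| - `|w - p| / Num.max w p) ^+ 2
    <= entry_bregman p w x dl + (w - p) ^+ 2 / Num.max w p.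
Proof.
move=> p0 w0 /andP[x1 x2] /andP[u1 u2]; rewrite /entry_bregman.
set m := Num.max w p; have m0 : 0 < m by rewrite lt_max p0 orbT.
have -> : m * (`|dl| - `|w - p| / m) ^+ 2 =
  m * `|dl| ^+ 2 - 2 * `|dl| * `|w - p| + `|w - p| ^+ 2 / m by field; lra.
rewrite lerD // !real_normK ?num_real //.
rewrite /m; have [wp|pw] := leP w p.
  rewrite (ler0_norm (_ : w - p <= 0)) ?subr_le0 //.
  have [d0|d0] := leP 0 dl.
    rewrite (ger0_norm d0).
    have : 0 <= (p - w) * (dl * (2 - dl - 2 * x)).
      by apply: mulr_ge0; [lra|apply: mulr_ge0; lra].
    lra.
  rewrite (ltr0_norm d0).
  have : 0 <= (p - w) * ((- dl) * (2 + dl + 2 * x)).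
    by apply: mulr_ge0; [lra|apply: mulr_ge0; lra].
  lra.
have wp0 : 0 <= w - p by lra.
rewrite (ger0_norm wp0).
have [d0|d0] := leP 0 dl.
  rewrite (ger0_norm d0).
  have : 0 <= (w - p) * (dl * (1 + x)).
    by apply: mulr_ge0; [lra|apply: mulr_ge0; lra].
  lra.
rewrite (ltr0_norm d0).
have : 0 <= (w - p) * ((- dl) * (1 - x)).
  by apply: mulr_ge0; [lra|apply: mulr_ge0; lra].
lra.
Qed.

Lemma entry_bregman_ge0 p w x dl : 0 < p -> 0 <= w -> -1 <= x <= 1 -> -1 <= x + dl <= 1 ->
  0 <= entry_bregman p w x dl + (w - p) ^+ 2 / Num.max w p.
Proof.
move=> p0 w0 hx hu; apply: le_trans (entry_bregman_ge p0 w0 hx hu).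
by rewrite mulr_ge0 ?sqr_ge0 // le_max w0.
Qed.

End Scalar.

(* Numerals and differences are matched first: unification would unfold the
   former, and addr_ge0 would split the latter. *)
Ltac nonneg := match goal with
  | |- is_true (0 <= _ - _) => lra
  | |- is_true (0 <= _ + _) => apply: addr_ge0; nonneg
  | |- is_true (0 <= _ ^+ 2) => exact: sqr_ge0
  | |- is_true (0 <= _ * _) => apply: mulr_ge0; nonneg
  | |- is_true (0 <= _%:R) => exact: ler0n
  | |- _ => first [assumption | exact: ltW | lra]
  end.

Section Area.
Variable R : realType.
Implicit Types p q w m k h P S D E : R.

(** Minimization over D and E, whose optimal values are (P + S / 6) / m and
(S + P / 6) / k. *)
Lemma area_square m k P S D E : 0 < m -> 0 < k ->
  P ^+ 2 / m - P * S / (3 * m) - S ^+ 2 / (36 * m) - S * P / (3 * k)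
    - P ^+ 2 / (36 * k)
  <= m * (D - P / m) ^+ 2 + P ^+ 2 / m + k * (E - S / k) ^+ 2
     - 3^-1 * (E * P + D * S).
Proof.
move=> m0 k0; rewrite -subr_ge0.
have -> : m * (D - P / m) ^+ 2 + P ^+ 2 / m + k * (E - S / k) ^+ 2
     - 3^-1 * (E * P + D * S) - (P ^+ 2 / m - P * S / (3 * m)
     - S ^+ 2 / (36 * m) - S * P / (3 * k) - P ^+ 2 / (36 * k))
  = m * (D - (P + S / 6) / m) ^+ 2 + k * (E - (S + P / 6) / k) ^+ 2.
  by field; lra.
by rewrite addr_ge0 // mulr_ge0 ?sqr_ge0 // ltW.
Qed.

(** What remains of the area inequality once D and E are eliminated. Here m, k, h
stand for max(w, p), max(q, p), max(w, q) and P, S, r for |w - p|, |q - p|,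
w - q. *)
Definition area_rest m k h P S (r : R) : R :=
  P ^+ 2 / m - P * S / (3 * m) - S ^+ 2 / (36 * m) - S * P / (3 * k)
    - P ^+ 2 / (36 * k) + r ^+ 2 / h.

(** Here w = p + a and q = p + b. After clearing denominators the only dangerous
term is - a^3, which the bounded ratio absorbs through a <= 7 p + 8 b. *)
Lemma rest_both_ge_w p a b : 0 < p -> 0 <= b -> b <= a -> p + a <= 8 * (p + b) ->
  0 <= area_rest (p + a) (p + b) (p + a) a b (a - b).
Proof.
move=> p0 b0 ba h.
have w0 : 0 < p + a by lra. have q0 : 0 < p + b by lra.
have -> : area_rest (p + a) (p + b) (p + a) a b (a - b) =
  (p * (71 * a ^+ 2 - 96 * a * b + 35 * b ^+ 2) +
    (60 * a ^+ 2 * b - a ^+ 3 - 84 * a * b ^+ 2 + 35 * b ^+ 3))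
  / (36 * (p + a) * (p + b)) by rewrite /area_rest; field; lra.
rewrite divr_ge0 //; last by nonneg.
have : 0 <= a ^+ 2 * (7 * p + 8 * b - a) by nonneg.
have [e e0 ->] : exists2 e, 0 <= e & a = b + e by exists (a - b); lra.
have : 0 <= p * (64 * e ^+ 2 + 32 * b * e + 3 * b ^+ 2).
  nonneg.
have : 0 <= b * (52 * e ^+ 2 + 20 * b * e + 3 * b ^+ 2).
  nonneg.
lra.
Qed.

Lemma rest_both_ge_q p a b : 0 < p -> 0 <= a -> a <= b -> p + b <= 8 * (p + a) ->
  0 <= area_rest (p + a) (p + b) (p + b) a b (a - b).
Proof.
move=> p0 a0 ab h.
have w0 : 0 < p + a by lra. have q0 : 0 < p + b by lra.
have -> : area_rest (p + a) (p + b) (p + b) a b (a - b) =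
  (p * (71 * a ^+ 2 - 96 * a * b + 35 * b ^+ 2) +
    (35 * a ^+ 3 - 48 * a ^+ 2 * b + 24 * a * b ^+ 2 - b ^+ 3))
  / (36 * (p + a) * (p + b)) by rewrite /area_rest; field; lra.
rewrite divr_ge0 //; last by nonneg.
(* Up to 7 a the term - b^3 is dominated by the other cubic terms; beyond, the
   bounded ratio gives b <= 7 p + 8 a. *)
have [b7|b7] := leP b (7 * a).
  have : 0 <= b ^+ 2 * (7 * a - b) by nonneg.
  have : 0 <= p * ((35 * b - 48 * a) ^+ 2 + 181 * a ^+ 2).
    nonneg.
  have : 0 <= a * ((17 * b - 24 * a) ^+ 2 + 19 * a ^+ 2).
    nonneg.
  lra.
have : 0 <= b ^+ 2 * (7 * p + 8 * a - b) by nonneg.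
have [e e0 ->] : exists2 e, 0 <= e & b = 7 * a + e by exists (b - 7 * a); lra.
have : 0 <= p * (28 * e ^+ 2 + 296 * a * e + 771 * a ^+ 2).
  nonneg.
have : 0 <= a * (16 * e ^+ 2 + 176 * a * e + 483 * a ^+ 2).
  nonneg.
lra.
Qed.

Lemma rest_both_le p h P S : 0 < h -> h <= p ->
  0 <= area_rest p p h P S (P - S).
Proof.
move=> h0 hp; have p0 : 0 < p by lra.
have : (P - S) ^+ 2 / p <= (P - S) ^+ 2 / h.
  by rewrite ler_wpM2l ?sqr_ge0 // lef_pV2.
have : 0 <= ((71 * P - 48 * S) ^+ 2 + 181 * S ^+ 2) / (71 * 36 * p).
  by rewrite divr_ge0 //; nonneg.
have -> : ((71 * P - 48 * S) ^+ 2 + 181 * S ^+ 2) / (71 * 36 * p) =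
  P ^+ 2 / p - P * S / (3 * p) - S ^+ 2 / (36 * p) - S * P / (3 * p)
    - P ^+ 2 / (36 * p) + (P - S) ^+ 2 / p by field; lra.
rewrite /area_rest; lra.
Qed.

Lemma rest_q_above p P S : 0 < p -> 0 <= P -> P <= p -> 0 <= S -> S <= 7 * p ->
  0 <= area_rest p (p + S) (p + S) P S (P + S).
Proof.
move=> p0 P0 Pp S0 Sp.
have -> : area_rest p (p + S) (p + S) P S (P + S) =
  (p * (71 * P ^+ 2 + 48 * P * S + 35 * S ^+ 2)
    + 36 * S * P ^+ 2 - 12 * P * S ^+ 2 - S ^+ 3) / (36 * p * (p + S)).
  by rewrite /area_rest; field; lra.
rewrite divr_ge0 //; last by nonneg.
have : 0 <= S ^+ 2 * (7 * p - S) by nonneg.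
have : 0 <= S ^+ 2 * (p - P) by nonneg.
have : 0 <= p * (71 * P ^+ 2 + 48 * P * S + 16 * S ^+ 2).
  nonneg.
have : 0 <= S * P ^+ 2 by nonneg.
lra.
Qed.

Lemma rest_w_above p P S : 0 < p -> 0 <= P -> P <= 7 * p -> 0 <= S -> S <= p ->
  0 <= area_rest (p + P) p (p + P) P S (P + S).
Proof.
move=> p0 P0 Pp S0 Sp.
have -> : area_rest (p + P) p (p + P) P S (P + S) =
  (p * (71 * P ^+ 2 + 48 * P * S + 35 * S ^+ 2)
    - 12 * S * P ^+ 2 - P ^+ 3) / (36 * p * (p + P)).
  by rewrite /area_rest; field; lra.
rewrite divr_ge0 //; last by nonneg.
have : 0 <= P ^+ 2 * (7 * p - P) by nonneg.
have : 0 <= P ^+ 2 * (p - S) by nonneg.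
have : 0 <= p * (52 * P ^+ 2 + 48 * P * S + 35 * S ^+ 2).
  nonneg.
lra.
Qed.
End Area.

Section AreaCell.
Variable R : realType.
Implicit Types p q w x m k h P S D E : R.

(** When w dwarfs p and q, |w - p|^2 / w and (w - q)^2 / w are both of the order
of w, and E <= 2 turns the term in E into one that is linear in w with a smaller
coefficient. *)
Lemma large_w p q w D E : 0 < p -> 0 < q -> 8 * p <= w -> 8 * q <= w ->
  0 <= D -> E <= 2 ->
  3^-1 * (E * `|w - p| + D * `|q - p|) <=
    w * (D - `|w - p| / w) ^+ 2 + `|w - p| ^+ 2 / w + (w - q) ^+ 2 / w.
Proof.
move=> p0 q0 pw qw D0 E2; have w0 : 0 < w by lra.
have wp : 0 <= w - p by lra.
rewrite (ger0_norm wp).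
have [s [s0 s1 es]] : exists s, [/\ 0 <= s, s <= 8^-1 & `|q - p| = s * w].
  exists (`|q - p| / w); rewrite divr_ge0 // ?(ltW w0) // ler_pdivrMr // mulfVK ?gt_eqF //.
  split=> //; rewrite ler_norml; lra.
rewrite es; have [r [r0 r1 er]] : exists r, [/\ 0 < r, r <= 8^-1 & p = r * w].
  by exists (p / w); rewrite divr_gt0 // ler_pdivrMr // mulfVK ?gt_eqF //; split=> //; lra.
have [t [t0 t1 et]] : exists t, [/\ 0 < t, t <= 8^-1 & q = t * w].
  by exists (q / w); rewrite divr_gt0 // ler_pdivrMr // mulfVK ?gt_eqF //; split=> //; lra.
rewrite er et -subr_ge0.
have -> : w * (D - (w - r * w) / w) ^+ 2 + (w - r * w) ^+ 2 / w + (w - t * w) ^+ 2 / w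
  - 3^-1 * (E * (w - r * w) + D * (s * w)) =
  w * ((D - (1 - r) - s / 6) ^+ 2 + (1 - r) ^+ 2 - (1 - r) * s / 3 - s ^+ 2 / 36
       + (1 - t) ^+ 2 - E * (1 - r) / 3) by field; lra.
apply: mulr_ge0; first exact: ltW.
have h1 := sqr_ge0 (D - (1 - r) - s / 6).
have h2 : 0 <= (1 - r) * (2 - E) by apply: mulr_ge0; lra.
have h3 : 0 <= (1 - r) * (8^-1 - s) by apply: mulr_ge0; lra.
have h4 : 0 <= s * (8^-1 - s) by apply: mulr_ge0; lra.
have h5 := sqr_ge0 t.
have h6 := sqr_ge0 (1 - r - 17 / 48).
lra.
Qed.

(** When q dwarfs p and w, the square in E and (w - q)^2 / q are enough, since
D <= 2 bounds the term in D by two thirds of q. *)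
Lemma large_q p q w D E : 0 < p -> 0 < w -> 8 * p <= q -> 8 * w <= q ->
  D <= 2 ->
  3^-1 * (E * `|w - p| + D * `|q - p|) <=
    q * (E - `|q - p| / q) ^+ 2 + (w - q) ^+ 2 / q.
Proof.
move=> p0 w0 pq wq D2; have q0 : 0 < q by lra.
have qp : 0 <= q - p by lra.
rewrite (ger0_norm qp).
have [s [s0 s1 es]] : exists s, [/\ 0 <= s, s <= 8^-1 & `|w - p| = s * q].
  exists (`|w - p| / q); rewrite divr_ge0 // ?(ltW q0) // ler_pdivrMr // mulfVK ?gt_eqF //.
  split=> //; rewrite ler_norml; lra.
rewrite es; have [r [r0 r1 er]] : exists r, [/\ 0 < r, r <= 8^-1 & p = r * q].
  by exists (p / q); rewrite divr_gt0 // ler_pdivrMr // mulfVK ?gt_eqF //; split=> //; lra.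
have [t [t0 t1 et]] : exists t, [/\ 0 < t, t <= 8^-1 & w = t * q].
  by exists (w / q); rewrite divr_gt0 // ler_pdivrMr // mulfVK ?gt_eqF //; split=> //; lra.
rewrite er et -subr_ge0.
have -> : q * (E - (q - r * q) / q) ^+ 2 + (t * q - q) ^+ 2 / q
  - 3^-1 * (E * (s * q) + D * (q - r * q)) =
  q * ((E - (1 - r) - s / 6) ^+ 2 - (1 - r) * s / 3 - s ^+ 2 / 36
       + (1 - t) ^+ 2 - D * (1 - r) / 3) by field; lra.
apply: mulr_ge0; first exact: ltW.
have h1 := sqr_ge0 (E - (1 - r) - s / 6).
have h2 : 0 <= (1 - r) * (2 - D) by apply: mulr_ge0; lra.
have h3 : 0 <= (1 - r) * (8^-1 - s) by apply: mulr_ge0; lra.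
have h4 : 0 <= s * (8^-1 - s) by apply: mulr_ge0; lra.
have h5 := sqr_ge0 (8^-1 - t).
lra.
Qed.

Lemma area_restN m k h P S r : area_rest m k h P S (- r) = area_rest m k h P S r.
Proof. by rewrite /area_rest sqrrN. Qed.

Lemma rest_ge0 p q w : 0 < p -> 0 < q -> 0 < w ->
  w <= 8 * Num.max p q -> q <= 8 * Num.max p w ->
  0 <= area_rest (Num.max w p) (Num.max q p) (Num.max w q) `|w - p| `|q - p| (w - q).
Proof.
move=> p0 q0 w0 hw hq.
have [wp|pw] := leP w p.
  have wp' : w - p <= 0 by lra.
  rewrite (ler0_norm wp').
  have [qp|pq] := leP q p.
    have qp' : q - p <= 0 by lra.
    rewrite (ler0_norm qp').
    have -> : w - q = - (- (w - p) - - (q - p)) by lra.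
    rewrite area_restN; apply: rest_both_le; first by rewrite lt_max w0.
    by rewrite ge_max wp qp.
  have pq' : 0 <= q - p by lra.
  rewrite (ger0_norm pq') (max_idPr (_ : w <= q)); last by lra.
  move: hq; rewrite (max_idPl wp) => hq.
  have -> : w - q = - (- (w - p) + (q - p)) by lra.
  have {1 2}-> : q = p + (q - p) by lra.
  by rewrite area_restN; apply: rest_q_above; lra.
have pw' : 0 <= w - p by lra.
rewrite (ger0_norm pw').
have [qp|pq] := leP q p.
  have qp' : q - p <= 0 by lra.
  rewrite (ler0_norm qp') (max_idPl (_ : q <= w)); last by lra.
  move: hw; rewrite (max_idPl qp) => hw.
  have -> : w - q = (w - p) + - (q - p) by lra.
  have {1 2}-> : w = p + (w - p) by lra.
  by apply: rest_w_above; lra.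
have pq' : 0 <= q - p by lra.
rewrite (ger0_norm pq').
move: hw hq; rewrite (max_idPr (ltW pq)) (max_idPr (ltW pw)) => hw hq.
have [wq|qw] := leP w q.
  have -> : w - q = (w - p) - (q - p) by lra.
  have {1}-> : w = p + (w - p) by lra.
  have {1 2}-> : q = p + (q - p) by lra.
  by apply: rest_both_ge_q; lra.
have -> : w - q = (w - p) - (q - p) by lra.
have {1 2}-> : w = p + (w - p) by lra.
have {1}-> : q = p + (q - p) by lra.
by apply: rest_both_ge_w; lra.
Qed.

(** Completing squares without using the bound 2 on D and E works as long as w and
q are within a factor 8 of the other weights; outside that range the bound 2 is
decisive. *)
Lemma area_unsigned p q w D E : 0 < p -> 0 < q -> 0 < w ->
  0 <= D <= 2 -> 0 <= E <= 2 ->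
  3^-1 * (E * `|w - p| + D * `|q - p|) <=
    Num.max w p * (D - `|w - p| / Num.max w p) ^+ 2
    + `|w - p| ^+ 2 / Num.max w p
    + Num.max q p * (E - `|q - p| / Num.max q p) ^+ 2
    + (w - q) ^+ 2 / Num.max w q.
Proof.
move=> p0 q0 w0 /andP[D0 D2] /andP[E0 E2].
have [hw|hw] := leP w (8 * Num.max p q); last first.
  have pw : 8 * p <= w by apply: le_trans (ltW hw); rewrite ler_pM2l // le_max lexx.
  have qw : 8 * q <= w by apply: le_trans (ltW hw); rewrite ler_pM2l // le_max lexx orbT.
  rewrite (max_idPl (_ : p <= w)); last by lra.
  rewrite (max_idPl (_ : q <= w)); last by lra.
  have := large_w p0 q0 pw qw D0 E2.
  have : 0 <= Num.max q p * (E - `|q - p| / Num.max q p) ^+ 2.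
    by rewrite mulr_ge0 ?sqr_ge0 // le_max (ltW q0).
  lra.
have [hq|hq] := leP q (8 * Num.max p w); last first.
  have pq : 8 * p <= q by apply: le_trans (ltW hq); rewrite ler_pM2l // le_max lexx.
  have wq : 8 * w <= q by apply: le_trans (ltW hq); rewrite ler_pM2l // le_max lexx orbT.
  rewrite (max_idPl (_ : p <= q)); last by lra.
  rewrite (max_idPr (_ : w <= q)); last by lra.
  have := @large_q p q w D E p0 w0 pq wq D2.
  have : 0 <= Num.max w p * (D - `|w - p| / Num.max w p) ^+ 2.
    by rewrite mulr_ge0 ?sqr_ge0 // le_max (ltW w0).
  have : 0 <= `|w - p| ^+ 2 / Num.max w p.
    by rewrite divr_ge0 ?sqr_ge0 // le_max (ltW w0).
  lra.
have m0 : 0 < Num.max w p by rewrite lt_max w0.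
have k0 : 0 < Num.max q p by rewrite lt_max q0.
have := area_square `|w - p| `|q - p| D E m0 k0.
have := rest_ge0 p0 q0 w0 hw hq; rewrite /area_rest; lra.
Qed.

(** The quantity in absolute value is twice the area of the triangle with vertices
(x, p), (x + dl, w), (x + et, q). The right-hand side is what one entry of the
matrix contributes to V4_z(w), to V2_z(z') and to twice a relative entropy, once
entropies are replaced by their quadratic lower bounds. *)
Lemma area_entry p q w x dl et : 0 < p -> 0 < q -> 0 < w ->
  -1 <= x <= 1 -> -1 <= x + dl <= 1 -> -1 <= x + et <= 1 ->
  3^-1 * `|et * (w - p) - dl * (q - p)| <=
    entry_bregman p w x dl + 2 * ((w - p) ^+ 2 / Num.max w p)
    + (entry_bregman p q x et + (q - p) ^+ 2 / Num.max q p)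
    + (w - q) ^+ 2 / Num.max w q.
Proof.
move=> p0 q0 w0 hx hd he.
have := entry_bregman_ge p0 (ltW w0) hx hd; have := entry_bregman_ge p0 (ltW q0) hx he.
have D2 : 0 <= `|dl| <= 2 by rewrite normr_ge0 ler_norml; lra.
have E2 : 0 <= `|et| <= 2 by rewrite normr_ge0 ler_norml; lra.
have := area_unsigned p0 q0 w0 D2 E2.
have : `|et * (w - p) - dl * (q - p)| <= `|et| * `|w - p| + `|dl| * `|q - p|.
  by rewrite -!normrM; exact: ler_normB.
rewrite -(normrX 2) (ger0_norm (sqr_ge0 (w - p))); lra.
Qed.
End AreaCell.

(** * Regularizer and its Bregman divergence *)

Definition KL (R : realType) (d : nat) (q p : 'I_d -> R) : R :=
  \sum_j kl (q j) (p j).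

Definition in_box (R : realType) (n : nat) (x : 'I_n -> R) : Prop :=
  forall i, -1 <= x i <= 1.

Definition in_simplex (R : realType) (d : nat) (q : 'I_d -> R) : Prop :=
  (forall j, 0 <= q j) /\ \sum_j q j = 1.

Definition positive (R : realType) (d : nat) (q : 'I_d -> R) : Prop :=
  forall j, 0 < q j.

(** Optimality of y for the problem of minimizing <w, y> + be KL(y|p) over the
simplex: the gradient is a constant vector, its value being the multiplier of
the constraint. *)
Definition is_mirror_step (R : realType) (d : nat) (be : R) (w p y : 'I_d -> R) : Prop :=
  [/\ positive y, \sum_j y j = 1 &
      exists cst, forall j, w j + be * (ln (y j) - ln (p j)) = cst].

Section Mirror.
Variables (R : realType) (d : nat).
Implicit Types p q w y : 'I_d -> R.

Lemma kl_three_point (q y p : R) :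
  kl q p - kl q y - kl y p = (ln y - ln p) * (q - y).
Proof. by rewrite /kl; ring. Qed.

Lemma KL_three_point q y p :
  KL q p - KL q y - KL y p = \sum_j (ln (y j) - ln (p j)) * (q j - y j).
Proof.
by rewrite /KL -!sumrB; apply: eq_bigr => j _; rewrite kl_three_point.
Qed.

Lemma KL_ge0 q p : (forall j, 0 <= q j) -> positive p -> 0 <= KL q p.
Proof. by move=> q0 p0; apply: sumr_ge0 => j _; apply: kl_ge0. Qed.

Lemma KLxx p : KL p p = 0.
Proof. by rewrite /KL big1 // => j _; rewrite /kl; ring. Qed.

Lemma KL_uniform q : in_simplex q -> KL q (fun=> d%:R^-1) <= ln d%:R.
Proof.
move=> [q0 q1].
have d0 : 0 < (d%:R : R).
  rewrite ltr0n lt0n; apply/eqP => d0; move: q1; rewrite big1 => [|[j jd]].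
    by move/eqP; rewrite eq_sym oner_eq0.
  by exfalso; move: jd; rewrite d0.
have -> : KL q (fun=> d%:R^-1) = \sum_j q j * ln (q j) + ln d%:R.
  transitivity (\sum_j (q j * ln (q j) + (ln d%:R * q j - q j + d%:R^-1))).
    by apply: eq_bigr => j _; rewrite /kl lnV ?posrE //; ring.
  rewrite big_split /=; congr (_ + _).
  rewrite big_split /= sumrB -mulr_sumr q1 sumr_const card_ord -(mulr_natl d%:R^-1).
  rewrite divff ?gt_eqF //; ring.
rewrite gerDr; apply: sumr_le0 => j _.
apply: mulr_ge0_le0 => //; apply: ln_le0.
rewrite -q1 (bigD1 j) //= lerDl; exact: sumr_ge0.
Qed.

(** The multiplier disappears because y and q have the same sum. *)
Lemma mirror_three_point be w p y q : is_mirror_step be w p y -> \sum_j q j = 1 ->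
  \sum_j w j * (y j - q j) = be * (KL q p - KL q y - KL y p).
Proof.
move=> [_ y1 [cst e]] q1; rewrite KL_three_point mulr_sumr.
transitivity (\sum_j (cst * (y j - q j) + be * ((ln (y j) - ln (p j)) * (q j - y j)))).
  by apply: eq_bigr => j _; rewrite -(e j); ring.
by rewrite big_split /= -mulr_sumr sumrB y1 q1 subrr mulr0 add0r.
Qed.
End Mirror.

Section Bregman.
Variables (R : realType) (n d : nat) (a : 'I_n -> 'I_d -> R).
Hypothesis a_ge0 : forall i j, 0 <= a i j.
Hypothesis a_col : forall j, \sum_i a i j <= 1.
Implicit Types (x u xs xb th gx : 'I_n -> R) (p q y pb gy w : 'I_d -> R).

Definition rowmass p i : R := \sum_j a i j * p j.
Definition colsq x j : R := \sum_i a i j * x i ^+ 2.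

Definition area_bregman x p u q : R :=
  \sum_i \sum_j a i j * entry_bregman (p j) (q j) (x i) (u i - x i).
(** Bregman divergence of the regularizer with entropy coefficient al, from (x, p)
to (u, q). *)
Definition bregman al x p u q : R := area_bregman x p u q + al * KL q p.

(** The proximal objective up to terms that depend on q alone: quadratic in u for
fixed weights q, and affine in q for fixed u. *)
Definition response_value th u q : R := \sum_i th i * u i + \sum_j q j * colsq u j.

(** First-order optimality, on the box, for [response_value] at weights p. In this
form it also covers rows without weight, where the objective is linear. *)
Definition is_best_response th p xs : Prop := in_box xs /\
  forall i (r : R), -1 <= r <= 1 ->
    (th i + 2 * rowmass p i * xs i) * (xs i - r) <= 0.

Lemma weighted_sum_le f : (forall j, 0 <= f j) ->
  \sum_i \sum_j a i j * f j <= \sum_j f j.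
Proof.
move=> f0; rewrite exchange_big /=; apply: ler_sum => j _.
by rewrite -mulr_suml ler_piMl.
Qed.

(** Column sums at most 1 let a single relative entropy pay for the quadratic
gaps of all the rows at once. *)
Lemma gap_le_KL q p : (forall j, 0 <= q j) -> positive p ->
  \sum_i \sum_j a i j * ((q j - p j) ^+ 2 / Num.max (q j) (p j)) <= 2 * KL q p.
Proof.
move=> q0 p0; apply: le_trans (weighted_sum_le _) _.
  by move=> j; rewrite divr_ge0 ?sqr_ge0 // le_max q0.
by rewrite /KL mulr_sumr; apply: ler_sum => j _; apply: kl_ge.
Qed.

Lemma in_box_diff x u i : in_box u -> -1 <= x i + (u i - x i) <= 1.
Proof. by move=> /(_ i); rewrite addrC subrK. Qed.

Lemma bregman_ge0 al x p u q : 2 <= al -> in_box x -> in_box u ->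
  (forall j, 0 <= q j) -> positive p -> 0 <= bregman al x p u q.
Proof.
move=> al2 hx hu q0 p0; have KL0 := KL_ge0 q0 p0.
have h : 0 <= (al - 2) * KL q p by apply: mulr_ge0; lra.
have := gap_le_KL q0 p0.
suff : 0 <= area_bregman x p u q +
  \sum_i \sum_j a i j * ((q j - p j) ^+ 2 / Num.max (q j) (p j)).
  by rewrite /bregman; lra.
rewrite -big_split /=; apply: sumr_ge0 => i _.
rewrite -big_split /=; apply: sumr_ge0 => j _.
rewrite -mulrDr mulr_ge0 // entry_bregman_ge0 //; exact: in_box_diff.
Qed.

Lemma colsq_exchange q u : \sum_j q j * colsq u j = \sum_i \sum_j a i j * (q j * u i ^+ 2).
Proof.
rewrite exchange_big /=; apply: eq_bigr => j _; rewrite mulr_sumr.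
by apply: eq_bigr => i _; ring.
Qed.

(** Optimality of xs at p bounds the linear part of the difference. What is left
is minus the Bregman divergence of sum_ij a_ij p_j x_i^2 from (xs, p) to (u, q),
and that divergence can be negative only by the amount [gap_le_KL]. *)
Lemma self_bounding th p xs u q : is_best_response th p xs -> in_box u -> positive p ->
  (forall j, 0 <= q j) -> response_value th xs q <= response_value th u q + 2 * KL q p.
Proof.
move=> [bxs o] bu p0 q0; have g := gap_le_KL q0 p0.
suff : 0 <= response_value th u q - response_value th xs q +
  \sum_i \sum_j a i j * ((q j - p j) ^+ 2 / Num.max (q j) (p j)) by lra.
rewrite /response_value !colsq_exchange.
have -> : forall s t v w g : R, s + t - (v + w) + g = (s - v) + (t - w + g).
  by move=> *; ring.
rewrite -!sumrB -!big_split /=; apply: sumr_ge0 => i _.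
rewrite -sumrB -big_split /=.
have := o i (u i) (bu i); set l := (X in X <= 0) => l0.
have -> : th i * u i - th i * xs i = - l + 2 * xs i * (xs i - u i) * rowmass p i.
  by rewrite /l; ring.
rewrite -addrA addr_ge0 ?oppr_ge0 // /rowmass mulr_sumr -big_split /=.
apply: sumr_ge0 => j _.
have -> : 2 * xs i * (xs i - u i) * (a i j * p j) +
   (a i j * (q j * u i ^+ 2) - a i j * (q j * xs i ^+ 2) +
    a i j * ((q j - p j) ^+ 2 / Num.max (q j) (p j))) =
   a i j * (entry_bregman (p j) (q j) (xs i) (u i - xs i) +
     (q j - p j) ^+ 2 / Num.max (q j) (p j)) by rewrite /entry_bregman; ring.
rewrite mulr_ge0 // entry_bregman_ge0 //; exact: in_box_diff.
Qed.

Lemma best_response_min th p xs u : is_best_response th p xs -> in_box u -> positive p ->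
  response_value th xs p <= response_value th u p.
Proof.
move=> o bu p0; have := self_bounding o bu p0 (fun j => ltW (p0 j)).
by rewrite KLxx mulr0 addr0.
Qed.

(** Gradient in x of the proximal objective <g, w> + V_z(w), without the part
2 u_i rowmass q i that the quadratic term produces at w = (u, q). *)
Definition shifted_grad gx x p i : R := gx i - 2 * x i * rowmass p i.

(** Brings the proximal objective into the form to which best responses apply. *)
Lemma area_bregmanE x p u q gx :
  area_bregman x p u q + \sum_i gx i * (u i - x i) =
  response_value (shifted_grad gx x p) u q - \sum_i shifted_grad gx x p i * x i
    - \sum_j q j * colsq x j.
Proof.
rewrite /response_value !colsq_exchange /area_bregman -big_split /=.
have -> : forall s t v w : R, s + t - v - w = (s - v) + (t - w) by move=> *; ring.
rewrite -!sumrB -big_split /=; apply: eq_bigr => i _.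
rewrite /shifted_grad.
have -> : (gx i - 2 * x i * rowmass p i) * u i - (gx i - 2 * x i * rowmass p i) * x i
  = gx i * (u i - x i) + (- (2 * x i * (u i - x i))) * rowmass p i by ring.
rewrite addrC -addrA; congr (_ + _).
rewrite /rowmass mulr_sumr -sumrB -big_split /=.
by apply: eq_bigr => j _; rewrite /entry_bregman; ring.
Qed.

Let subDl (t s r : R) : t + s - (t + r) = s - r.
Proof. by ring. Qed.

(** With an exact proximal step the right-hand side would be 2 KL(q|p) smaller.
The step in y sees the best response xs to p instead of the one to y', and
[self_bounding] charges that amount. *)
Lemma gradient_step gx gy x p xs x' y' u q :
  in_box x -> positive p -> in_box u -> in_simplex q ->
  is_best_response (shifted_grad gx x p) p xs ->
  is_mirror_step 2 (fun j => gy j + colsq xs j - colsq x j) p y' ->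
  is_best_response (shifted_grad gx x p) y' x' ->
  \sum_i gx i * (x' i - u i) + \sum_j gy j * (y' j - q j) + bregman 2 x p x' y'
    <= bregman 4 x p u q - 2 * KL q y'.
Proof.
move=> bx p0 bu [q0 q1] oxs mir ox'.
have [y'0 y'1 _] := mir.
have := mirror_three_point mir q1.
have := self_bounding oxs bu p0 q0.
have := best_response_min ox' oxs.1 y'0.
rewrite /bregman.
have e1 := area_bregmanE x p x' y' gx; have e2 := area_bregmanE x p u q gx.
have -> : \sum_i gx i * (x' i - u i) =
  \sum_i gx i * (x' i - x i) - \sum_i gx i * (u i - x i).
  by rewrite -sumrB; apply: eq_bigr => i _; ring.
have -> : \sum_j (gy j + colsq xs j - colsq x j) * (y' j - q j) =
  \sum_j gy j * (y' j - q j) + (response_value (shifted_grad gx x p) xs y' - response_value (shifted_grad gx x p) xs q)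
  - (\sum_j y' j * colsq x j - \sum_j q j * colsq x j).
  rewrite /response_value subDl -!sumrB -!big_split /= -sumrB.
  by apply: eq_bigr => j _; ring.
lra.
Qed.

Lemma area_bregman_three_point x p u q x1 y1 :
  area_bregman x p u q - area_bregman x1 y1 u q - area_bregman x p x1 y1 =
  \sum_i 2 * (x1 i * rowmass y1 i - x i * rowmass p i) * (u i - x1 i)
  + \sum_j (colsq x1 j - colsq x j) * (q j - y1 j).
Proof.
have -> : \sum_j (colsq x1 j - colsq x j) * (q j - y1 j) =
  \sum_i \sum_j a i j * ((x1 i ^+ 2 - x i ^+ 2) * (q j - y1 j)).
  rewrite exchange_big /=; apply: eq_bigr => j _.
  by rewrite -sumrB mulr_suml; apply: eq_bigr => i _; ring.
rewrite /area_bregman -!sumrB -big_split /=; apply: eq_bigr => i _.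
have -> : 2 * (x1 i * rowmass y1 i - x i * rowmass p i) * (u i - x1 i) =
  (2 * x1 i * (u i - x1 i)) * rowmass y1 i - (2 * x i * (u i - x1 i)) * rowmass p i.
  by ring.
rewrite /rowmass !mulr_sumr -!sumrB -big_split /=.
by apply: eq_bigr => j _; rewrite /entry_bregman; ring.
Qed.

(** By the three-point identities the claim is the first-order condition at
(x1, y1) up to an error. In x the condition is exact. In y, the mirror step to pb1
uses the right gradient, and the mirror step to y1 uses the gradient at xb instead
of x1; the error is the change of gradient tested against y1 - pb1. By
[best_response_min] at y1 and [self_bounding] at pb1 it is at most 2 KL(pb1|pb),
and the mirror step to pb1 leaves - 4 KL(pb1|pb) to absorb it. *)
Lemma extragradient_step gx gy x p pb xb x1 y1 pb1 u q :
  positive p -> positive pb -> in_box u -> in_simplex q ->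
  is_best_response (shifted_grad gx x p) pb xb ->
  is_mirror_step 4 (fun j => gy j + colsq xb j + 4 * ln (pb j) - colsq x j - 4 * ln (p j))
    pb y1 ->
  is_best_response (shifted_grad gx x p) y1 x1 ->
  is_mirror_step 4 (fun j => gy j + colsq x1 j + 4 * ln (y1 j) - colsq x j - 4 * ln (p j))
    pb pb1 ->
  \sum_i gx i * (x1 i - u i) + \sum_j gy j * (y1 j - q j)
    <= bregman 4 x p u q - bregman 4 x1 y1 u q - bregman 4 x p x1 y1
       + 4 * KL q pb - 4 * KL q pb1.
Proof.
move=> p0 pb0 bu [q0 q1] oxb m1 ox1 m2.
have [y10 y11 [cst e]] := m1; have [pb10 pb11 _] := m2.
have K0 := KL_ge0 (fun j => ltW (pb10 j)) pb0.
have t3 := mirror_three_point m2 q1.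
have s1 := self_bounding oxb ox1.1 pb0 (fun j => ltW (pb10 j)).
have s2 := best_response_min ox1 oxb.1 y10.
have kq := KL_three_point q y1 p.
have xq := area_bregman_three_point x p u q x1 y1.
have fx : \sum_i (shifted_grad gx x p i + 2 * rowmass y1 i * x1 i) * (x1 i - u i) <= 0.
  by apply: sumr_le0 => i _; apply: ox1.2.
have ex : \sum_i (shifted_grad gx x p i + 2 * rowmass y1 i * x1 i) * (x1 i - u i) =
  \sum_i gx i * (x1 i - u i)
  - \sum_i 2 * (x1 i * rowmass y1 i - x i * rowmass p i) * (u i - x1 i).
  by rewrite -sumrB; apply: eq_bigr => i _; rewrite /shifted_grad; ring.
(* y1 was computed against xb, so its stationarity condition involves xb where
   the gradient at the new iterate has x1. *)
have fy : \sum_j (gy j + colsq xb j + 4 * ln (y1 j) - colsq x j - 4 * ln (p j))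
            * (y1 j - pb1 j) = 0.
  transitivity (\sum_j cst * (y1 j - pb1 j)).
    by apply: eq_bigr => j _; rewrite -(e j); ring.
  by rewrite -mulr_sumr sumrB y11 pb11 subrr mulr0.
have ey : \sum_j (gy j + colsq x1 j + 4 * ln (y1 j) - colsq x j - 4 * ln (p j))
            * (pb1 j - q j) =
  \sum_j gy j * (y1 j - q j)
  - \sum_j (colsq x1 j - colsq x j) * (q j - y1 j)
  - 4 * \sum_j (ln (y1 j) - ln (p j)) * (q j - y1 j)
  - \sum_j (gy j + colsq xb j + 4 * ln (y1 j) - colsq x j - 4 * ln (p j))
            * (y1 j - pb1 j)
  - (response_value (shifted_grad gx x p) x1 y1 - response_value (shifted_grad gx x p) x1 pb1
     - (response_value (shifted_grad gx x p) xb y1 - response_value (shifted_grad gx x p) xb pb1)).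
  rewrite /response_value !subDl mulr_sumr -!sumrB.
  by apply: eq_bigr => j _; ring.
rewrite /bregman; lra.
Qed.

Variable A : 'I_n -> 'I_d -> R.
Hypothesis A_le : forall i j, `|A i j| <= a i j.
Variables (b : 'I_d -> R) (c : 'I_n -> R).

Definition gradx y i : R := \sum_j A i j * y j + c i.
Definition grady x j : R := b j - \sum_i A i j * x i.
Definition game x y : R :=
  \sum_i \sum_j A i j * (x i * y j) - \sum_j b j * y j + \sum_i c i * x i.

(** Linearizing a bilinear game loses nothing: the regret is the duality gap. *)
Lemma grad_gap x' y' u q :
  \sum_i gradx y' i * (x' i - u i) + \sum_j grady x' j * (y' j - q j)
  = game x' q - game u y'.
Proof.
have -> : \sum_i gradx y' i * (x' i - u i) =
  \sum_i \sum_j A i j * (x' i * y' j) - \sum_i \sum_j A i j * (u i * y' j)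
  + (\sum_i c i * x' i - \sum_i c i * u i).
  rewrite -!sumrB -big_split /=; apply: eq_bigr => i _.
  rewrite /gradx mulrDl mulr_suml -sumrB; congr (_ + _); last by ring.
  by apply: eq_bigr => j _; ring.
have -> : \sum_j grady x' j * (y' j - q j) =
  \sum_i \sum_j A i j * (x' i * q j) - \sum_i \sum_j A i j * (x' i * y' j)
  + (\sum_j b j * y' j - \sum_j b j * q j).
  rewrite exchange_big [X in _ - X + _]exchange_big /=.
  rewrite -!sumrB -big_split /=; apply: eq_bigr => j _.
  rewrite /grady mulrBl mulr_suml -sumrB addrC -sumrN; congr (_ + _); first by ring.
  by apply: eq_bigr => i _; ring.
rewrite /game; ring.
Qed.

(** The bilinear terms cancel entry by entry, up to the area of a triangle. *)
Lemma area_convexity x p x' y' x1 y1 :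
  in_box x -> in_box x' -> in_box x1 -> positive p -> positive y' -> positive y1 ->
  3^-1 * (\sum_i (gradx y' i - gradx p i) * (x' i - x1 i)
    + \sum_j (grady x' j - grady x j) * (y' j - y1 j))
  <= bregman 4 x p x1 y1 + bregman 2 x p x' y' + 2 * KL y1 y'.
Proof.
move=> bx bx' bx1 p0 y'0 y10.
have -> : \sum_i (gradx y' i - gradx p i) * (x' i - x1 i)
    + \sum_j (grady x' j - grady x j) * (y' j - y1 j) =
  \sum_i \sum_j A i j * ((x' i - x i) * (y1 j - p j) - (x1 i - x i) * (y' j - p j)).
  have -> : \sum_j (grady x' j - grady x j) * (y' j - y1 j) =
    \sum_i \sum_j A i j * ((x i - x' i) * (y' j - y1 j)).
    rewrite exchange_big /=; apply: eq_bigr => j _.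
    have -> : grady x' j - grady x j = \sum_i (A i j * x i - A i j * x' i).
      by rewrite sumrB /grady; ring.
    by rewrite mulr_suml; apply: eq_bigr => i _; ring.
  rewrite -big_split /=; apply: eq_bigr => i _.
  have -> : gradx y' i - gradx p i = \sum_j (A i j * y' j - A i j * p j).
    by rewrite sumrB /gradx; ring.
  rewrite mulr_suml -big_split /=.
  by apply: eq_bigr => j _; ring.
have g1 := gap_le_KL (fun j => ltW (y10 j)) p0.
have g2 := gap_le_KL (fun j => ltW (y'0 j)) p0.
have g3 := gap_le_KL (fun j => ltW (y10 j)) y'0.
rewrite /bregman.
suff : 3^-1 * (\sum_i \sum_j A i j *
     ((x' i - x i) * (y1 j - p j) - (x1 i - x i) * (y' j - p j))) <=
  area_bregman x p x1 y1
  + 2 * (\sum_i \sum_j a i j * ((y1 j - p j) ^+ 2 / Num.max (y1 j) (p j)))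
  + (area_bregman x p x' y'
    + \sum_i \sum_j a i j * ((y' j - p j) ^+ 2 / Num.max (y' j) (p j)))
  + \sum_i \sum_j a i j * ((y1 j - y' j) ^+ 2 / Num.max (y1 j) (y' j)) by lra.
rewrite /area_bregman !mulr_sumr -!big_split /=; apply: ler_sum => i _.
rewrite !mulr_sumr -!big_split /=; apply: ler_sum => j _.
have := area_entry (p0 j) (y'0 j) (y10 j) (bx i) (in_box_diff x i bx1)
  (in_box_diff x i bx').
set t := _ - _ => ht.
have : A i j * t <= a i j * `|t|.
  apply: le_trans (ler_norm _) _; rewrite normrM; exact: ler_wpM2r.
have := ler_wpM2l (a_ge0 i j) ht.
lra.
Qed.

(** Half of [gradient_step] with comparator (x1, y1), plus half of
[area_convexity], bounds <g(z'), z' - z1> / 6 by V4_z(z1). This is the negative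
term of [extragradient_step]. *)
Lemma iteration_progress x p pb xs x' y' xb x1 y1 pb1 u q :
  in_box x -> positive p -> positive pb -> in_box u -> in_simplex q ->
  let gx := fun i => 3^-1 * gradx p i in
  let gy := fun j => 3^-1 * grady x j in
  is_best_response (shifted_grad gx x p) p xs ->
  is_mirror_step 2 (fun j => gy j + colsq xs j - colsq x j) p y' ->
  is_best_response (shifted_grad gx x p) y' x' ->
  let hx := fun i => 6^-1 * gradx y' i in
  let hy := fun j => 6^-1 * grady x' j in
  is_best_response (shifted_grad hx x p) pb xb ->
  is_mirror_step 4 (fun j => hy j + colsq xb j + 4 * ln (pb j) - colsq x j - 4 * ln (p j))
    pb y1 ->
  is_best_response (shifted_grad hx x p) y1 x1 ->
  is_mirror_step 4 (fun j => hy j + colsq x1 j + 4 * ln (y1 j) - colsq x j - 4 * ln (p j))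
    pb pb1 ->
  6^-1 * (game x' q - game u y') <=
    (bregman 4 x p u q + 4 * KL q pb) - (bregman 4 x1 y1 u q + 4 * KL q pb1).
Proof.
move=> bx p0 pb0 bu sq gx gy oxs my' ox' hx hy oxb my1 ox1 mpb1.
have [y10 y11 _] := my1; have [y'0 y'1 _] := my'.
have sy1 : in_simplex y1 by split=> // j; exact: ltW.
have e := extragradient_step p0 pb0 bu sq oxb my1 ox1 mpb1.
have g := gradient_step bx p0 ox1.1 sy1 oxs my' ox'.
have ar := area_convexity bx ox'.1 ox1.1 p0 y'0 y10.
have gg := grad_gap x' y' u q.
have e1 : \sum_i hx i * (x1 i - u i) + \sum_j hy j * (y1 j - q j) =
  6^-1 * (\sum_i gradx y' i * (x' i - u i) + \sum_j grady x' j * (y' j - q j))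
  - 6^-1 * (\sum_i (gradx y' i - gradx p i) * (x' i - x1 i)
    + \sum_j (grady x' j - grady x j) * (y' j - y1 j))
  - 2^-1 * (\sum_i gx i * (x' i - x1 i) + \sum_j gy j * (y' j - y1 j)).
  rewrite !mulrDr !mulr_sumr !opprD -!sumrN.
  have -> : forall s1 s2 s3 s4 s5 s6 : R,
    s1 + s2 + (s3 + s4) + (s5 + s6) = (s1 + s3 + s5) + (s2 + s4 + s6).
    by move=> *; ring.
  rewrite -!big_split /=; congr (_ + _); apply: eq_bigr => k _;
  rewrite /hx /hy /gx /gy; lra.
lra.
Qed.

End Bregman.

(** * One pass of the loop *)

Definition entry (R : realType) (k : nat) (v : 'cV[R]_k) : 'I_k -> R :=
  fun i => v i 0.

Section Projections.
Variable R : realType.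

Lemma truncate_EFin (r : R) : truncate r%:E = Num.max (-1) (Num.min 1 r).
Proof. by rewrite /truncate -EFin_min -EFin_max. Qed.

Lemma truncate_pinfty : truncate +oo%E = 1 :> R.
Proof.
rewrite /truncate; have -> : mine 1%:E (+oo%E : \bar R) = 1%:E by rewrite minEle leey.
by rewrite -EFin_max /= maxEle ifT //; lra.
Qed.

Lemma truncate_ninfty : truncate -oo%E = -1 :> R.
Proof.
rewrite /truncate; have -> : mine 1%:E (-oo%E : \bar R) = -oo%E by rewrite minEle.
by rewrite maxEle.
Qed.

(** For q = 0 the objective is linear, and the infinite quotient is truncated to
the endpoint of [-1, 1] where it is smallest. *)
Lemma truncate_quot_opt (p q : R) : 0 <= q ->
  let r := truncate (oppe (equot p q)) in
  -1 <= r <= 1 /\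
  forall u : R, -1 <= u <= 1 -> (p + q * r) * (r - u) <= 0.
Proof.
move=> q0 /=; rewrite /equot; case: (eqVneq q 0) => [->|qn0].
  have [->|pn0] := eqVneq p 0.
    rewrite oppe0 truncate_EFin minEle ifN ?ler10 // maxEle ifT; last by lra.
    by split=> [|u _]; [lra | rewrite mul0r addr0 mul0r].
  have [pp|pn] := ltP 0 p.
    rewrite /= truncate_ninfty; split=> [|u /andP[u1 u2]]; first lra.
    have : 0 <= p * (1 + u) by apply: mulr_ge0; lra.
    lra.
  rewrite /= truncate_pinfty; split=> [|u /andP[u1 u2]]; first lra.
  have : 0 <= (- p) * (1 - u) by apply: mulr_ge0; lra.
  lra.
have qp : 0 < q by rewrite lt_def qn0.
rewrite -EFinN truncate_EFin; set s := - (p / q).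
have es : p = - (q * s) by rewrite /s; field.
have [s1|s1] := leP 1 s.
  rewrite maxEle ifT; last by lra.
  split=> [|u /andP[u1 u2]]; first lra.
  have : 0 <= q * ((s - 1) * (1 - u)).
    by apply: mulr_ge0; [lra|apply: mulr_ge0; lra].
  rewrite es; lra.
rewrite maxEle; case: (leP (-1) s) => s2.
  split=> [|u /andP[u1 u2]]; first lra.
  rewrite es; lra.
split=> [|u /andP[u1 u2]]; first lra.
have : 0 <= q * ((-1 - s) * (1 + u)).
  by apply: mulr_ge0; [lra|apply: mulr_ge0; lra].
rewrite es; lra.
Qed.

Lemma mulmx_entry n d (A : 'M[R]_(n, d)) (y : 'cV[R]_d) i :
  (A *m y) i 0 = \sum_j A i j * y j 0.
Proof. by rewrite mxE. Qed.

Variables (n d : nat) (A : 'M[R]_(n, d)).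
Let a i j := `|A i j|.

Lemma absmx_rowmass (y : 'cV[R]_d) i : (absmx A *m y) i 0 = rowmass a (entry y) i.
Proof. by rewrite mxE; apply: eq_bigr => j _; rewrite mxE. Qed.

Lemma absmx_colsq (x : 'cV[R]_n) j :
  ((absmx A)^T *m sqmx x) j 0 = colsq a (entry x) j.
Proof. by rewrite mxE; apply: eq_bigr => i _; rewrite !mxE. Qed.

Lemma rowmass_ge0 (p : 'I_d -> R) i : positive p -> 0 <= rowmass a p i.
Proof.
move=> p0; apply: sumr_ge0 => j _; apply: mulr_ge0; first exact: normr_ge0.
exact: ltW.
Qed.

Lemma projX_best_response (gx x : 'cV[R]_n) (p y : 'cV[R]_d) : positive (entry y) ->
  is_best_response a (shifted_grad a (entry gx) (entry x) (entry p)) (entry y)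
    (entry (projX_quot (gx - 2 *: (diag_mx x^T *m (absmx A *m p)))
                       (2 *: (absmx A *m y)))).
Proof.
move=> y0.
have q0 i : 0 <= 2 * rowmass a (entry y) i by rewrite mulr_ge0 // rowmass_ge0.
split=> [i|i u hu]; rewrite /entry mxE.
  rewrite [X in equot _ X]mxE absmx_rowmass; set num := (X in equot X _).
  by have [] := truncate_quot_opt num (q0 i).
rewrite [X in equot _ X]mxE absmx_rowmass.
set num := (X in equot X _).
have -> : shifted_grad a (entry gx) (entry x) (entry p) i = num.
  by rewrite /num /shifted_grad /entry mul_diag_mx !mxE -absmx_rowmass mxE; ring.
by have [_] := truncate_quot_opt num (q0 i); exact.
Qed.

Lemma projY_mirror_step k (be : R) (p w : 'cV[R]_k.+1) (w' : 'I_k.+1 -> R) : be != 0 ->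
  positive (entry p) -> (forall j, w' j = w j 0) ->
  is_mirror_step be w' (entry p) (entry (projY (hadamard p (expmx (- be^-1 *: w))))).
Proof.
move=> be0 p0 ew; set h := hadamard _ _.
have h0 j : 0 < h j 0 by rewrite !mxE mulr_gt0 ?expR_gt0 //; exact: p0.
have l1 : l1norm h = \sum_j h j 0.
  by apply: eq_bigr => j _; rewrite gtr0_norm.
have l0 : 0 < l1norm h.
  by rewrite l1 big_ord_recl ltr_pwDl // sumr_ge0 // => j _; rewrite ltW.
split.
- by move=> j; rewrite /entry mxE mulr_gt0 // invr_gt0.
- under eq_bigr => j _ do rewrite /entry mxE.
  by rewrite -mulr_sumr -l1 mulVf // gt_eqF.
- exists (- be * ln (l1norm h)) => j.
  rewrite /entry mxE lnM ?posrE ?invr_gt0 // lnV ?posrE // ew.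
  rewrite /h !mxE lnM ?posrE ?expR_gt0 //; last exact: p0.
  rewrite expRK; field; exact: be0.
Qed.
End Projections.

(** * Correctness *)

Section Correctness.
Variables (R : realType) (n d : nat).
Implicit Types (A : 'M[R]_(n, d.+1)) (b : 'cV[R]_d.+1) (c : 'cV[R]_n).

(** Positivity of y and ybar keeps their logarithms meaningful. *)
Definition admissible (z : iterate R n d.+1) : Prop :=
  [/\ in_box (entry (it_x z)), positive (entry (it_y z)) &
      positive (entry (it_ybar z))].

Definition potential A (z : iterate R n d.+1) (u : 'I_n -> R) (q : 'I_d.+1 -> R) : R :=
  bregman (fun i j => `|A i j|) 4 (entry (it_x z)) (entry (it_y z)) u q
  + 4 * KL q (entry (it_ybar z)).

Lemma colD k (v w : 'cV[R]_k) j : (v + w) j 0 = v j 0 + w j 0.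
Proof. by rewrite mxE. Qed.
Lemma colB k (v w : 'cV[R]_k) j : (v - w) j 0 = v j 0 - w j 0.
Proof. by rewrite !mxE. Qed.
Lemma colZ k (r : R) (v : 'cV[R]_k) j : (r *: v) j 0 = r * v j 0.
Proof. by rewrite mxE. Qed.
Lemma col_ln k (v : 'cV[R]_k) j : lnmx v j 0 = ln (v j 0).
Proof. by rewrite mxE. Qed.
Definition entryE := (colB, colD, colZ, col_ln).

Lemma bs_step_progress A b c T z :
  (forall j, \sum_i `|A i j| <= 1) -> admissible z ->
  forall z1, z1 = bs_step A b c T z ->
  admissible z1 /\
  exists (x' : 'cV[R]_n) (y' : 'cV[R]_d.+1),
    [/\ it_xhat z1 = it_xhat z + T%:R^-1 *: x',
        it_yhat z1 = it_yhat z + T%:R^-1 *: y',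
        in_box (entry x'), in_simplex (entry y') &
        forall u q, in_box u -> in_simplex q ->
          6^-1 * (game A (entry b) (entry c) (entry x') q
                  - game A (entry b) (entry c) u (entry y'))
          <= potential A z u q - potential A z1 u q].
Proof.
case: z => x y yb xh yh colA [/= bx y0 yb0] z1 ez.
pose gx := 3^-1 *: (A *m y + c); pose gy := 3^-1 *: (b - A^T *m x).
pose xs := projX_quot (gx - 2 *: (diag_mx x^T *m (absmx A *m y))) (2 *: (absmx A *m y)).
pose y' := projY (hadamard y (expmx (- 2^-1 *: (gy + (absmx A)^T *m sqmx xs
            - (absmx A)^T *m sqmx x)))).
pose x' := projX_quot (gx - 2 *: (diag_mx x^T *m (absmx A *m y))) (2 *: (absmx A *m y')).
pose hx := 6^-1 *: (A *m y' + c); pose hy := 6^-1 *: (b - A^T *m x').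
pose num := hx - 2 *: (diag_mx x^T *m (absmx A *m y)).
pose xb := projX_quot num (2 *: (absmx A *m yb)).
pose y1 := projY (hadamard yb (expmx (- 4^-1 *: (hy + (absmx A)^T *m sqmx xb
            + 4 *: lnmx yb - (absmx A)^T *m sqmx x - 4 *: lnmx y)))).
pose x1 := projX_quot num (2 *: (absmx A *m y1)).
pose yb1 := projY (hadamard yb (expmx (- 4^-1 *: (hy + (absmx A)^T *m sqmx x1
            + 4 *: lnmx y1 - (absmx A)^T *m sqmx x - 4 *: lnmx y)))).
(* The names above follow the local definitions of bs_step, so that this holds by
   computation. *)
have {}ez : z1 = Iterate x1 y1 yb1 (xh + T%:R^-1 *: x') (yh + T%:R^-1 *: y').
  by rewrite ez.
have oxs := projX_best_response A gx x y y0.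
have my' : is_mirror_step 2 (fun j => entry gy j + colsq (fun i j => `|A i j|) (entry xs) j
    - colsq (fun i j => `|A i j|) (entry x) j) (entry y) (entry y').
  by apply: projY_mirror_step => // j; rewrite -!absmx_colsq /entry !entryE.
have [y'0 y'1 _] := my'.
have ox' := projX_best_response A gx x y y'0.
have oxb := projX_best_response A hx x y yb0.
have my1 : is_mirror_step 4 (fun j => entry hy j + colsq (fun i j => `|A i j|) (entry xb) j
    + 4 * ln (entry yb j) - colsq (fun i j => `|A i j|) (entry x) j
    - 4 * ln (entry y j)) (entry yb) (entry y1).
  by apply: projY_mirror_step => // j; rewrite -!absmx_colsq /entry !entryE.
have [y10 y11 _] := my1.
have ox1 := projX_best_response A hx x y y10.
have myb1 : is_mirror_step 4 (fun j => entry hy j + colsq (fun i j => `|A i j|) (entry x1) j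
    + 4 * ln (entry y1 j) - colsq (fun i j => `|A i j|) (entry x) j
    - 4 * ln (entry y j)) (entry yb) (entry yb1).
  by apply: projY_mirror_step => // j; rewrite -!absmx_colsq /entry !entryE.
have [yb10 yb11 _] := myb1.
rewrite {z1}ez /=.
split; first by split; [exact: ox1.1 | exact: y10 | exact: yb10].
exists x', y'; split; [reflexivity | reflexivity | exact: ox'.1 | | ].
  by split; [move=> j; exact: ltW | exact: y'1].
have egx : entry gx = (fun i => 3^-1 * gradx A (entry c) (entry y) i).
  by apply/funext => i; rewrite /entry /gradx !entryE mulmx_entry.
have egy : entry gy = (fun j => 3^-1 * grady A (entry b) (entry x) j).
  apply/funext => j; rewrite /entry /grady !entryE mulmx_entry.
  by congr (_ * (_ - _)); apply: eq_bigr => i _; rewrite mxE.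
have ehx : entry hx = (fun i => 6^-1 * gradx A (entry c) (entry y') i).
  by apply/funext => i; rewrite /entry /gradx !entryE mulmx_entry.
have ehy : entry hy = (fun j => 6^-1 * grady A (entry b) (entry x') j).
  apply/funext => j; rewrite /entry /grady !entryE mulmx_entry.
  by congr (_ * (_ - _)); apply: eq_bigr => i _; rewrite mxE.
rewrite egx in oxs ox'; rewrite egy in my'; rewrite ehx in oxb ox1.
rewrite ehy in my1 myb1.
move=> u q bu sq; rewrite /potential.
apply: (iteration_progress (A := fun i j => A i j) _ colA _ bx y0 yb0 bu sq oxs my' ox'
  oxb my1 ox1 myb1); [move=> i j; exact: normr_ge0 | move=> i j; exact: lexx].
Qed.

End Correctness.

Section Convergence.
Variables (R : realType) (n d : nat).
Implicit Types (A : 'M[R]_(n, d.+1)) (b : 'cV[R]_d.+1) (c : 'cV[R]_n).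

(** The duality gap of (xh, yh) against (u, q), with weight r on the terms in which
xh and yh do not occur. It is affine in (r, xh, yh), so that it follows the sums
built up in xhat and yhat; after k passes out of T, r = k / T. *)
Definition weighted_gap A (b : 'I_d.+1 -> R) (c : 'I_n -> R) (r : R)
    (xh : 'I_n -> R) (yh : 'I_d.+1 -> R) u q : R :=
  \sum_i \sum_j A i j * (xh i * q j) - r * (\sum_j b j * q j) + \sum_i c i * xh i
  - (\sum_i \sum_j A i j * (u i * yh j) - \sum_j b j * yh j + r * (\sum_i c i * u i)).

Lemma weighted_gap1 A (b : 'I_d.+1 -> R) (c : 'I_n -> R) xh yh u q :
  weighted_gap A b c 1 xh yh u q = game A b c xh q - game A b c u yh.
Proof. by rewrite /weighted_gap /game !mul1r. Qed.

Lemma weighted_gap0 A (b : 'I_d.+1 -> R) (c : 'I_n -> R) u q :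
  weighted_gap A b c 0 (fun=> 0) (fun=> 0) u q = 0.
Proof.
rewrite /weighted_gap !mul0r.
have -> : \sum_i \sum_j A i j * (0 * q j) = 0.
  by rewrite big1 // => i _; rewrite big1 // => j _; rewrite mul0r mulr0.
have -> : \sum_i \sum_j A i j * (u i * 0) = 0.
  by rewrite big1 // => i _; rewrite big1 // => j _; rewrite !mulr0.
rewrite [\sum_i c i * 0]big1; last by move=> i _; rewrite mulr0.
rewrite [\sum_j b j * 0]big1; last by move=> i _; rewrite mulr0.
ring.
Qed.

Lemma weighted_gap_add A (b : 'I_d.+1 -> R) (c : 'I_n -> R) r s (xh x' : 'I_n -> R) (yh y' : 'I_d.+1 -> R) u q :
  weighted_gap A b c (r + s) (fun i => xh i + s * x' i) (fun j => yh j + s * y' j) u q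
  = weighted_gap A b c r xh yh u q + s * (game A b c x' q - game A b c u y').
Proof.
rewrite /weighted_gap /game.
have -> : \sum_i \sum_j A i j * ((xh i + s * x' i) * q j) =
  \sum_i \sum_j A i j * (xh i * q j) + s * \sum_i \sum_j A i j * (x' i * q j).
  rewrite mulr_sumr -big_split; apply: eq_bigr => i _ /=.
  by rewrite mulr_sumr -big_split; apply: eq_bigr => j _ /=; ring.
have -> : \sum_i \sum_j A i j * (u i * (yh j + s * y' j)) =
  \sum_i \sum_j A i j * (u i * yh j) + s * \sum_i \sum_j A i j * (u i * y' j).
  rewrite mulr_sumr -big_split; apply: eq_bigr => i _ /=.
  by rewrite mulr_sumr -big_split; apply: eq_bigr => j _ /=; ring.
have -> : \sum_i c i * (xh i + s * x' i) = \sum_i c i * xh i + s * \sum_i c i * x' i.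
  by rewrite mulr_sumr -big_split; apply: eq_bigr => i _ /=; ring.
have -> : \sum_j b j * (yh j + s * y' j) = \sum_j b j * yh j + s * \sum_j b j * y' j.
  by rewrite mulr_sumr -big_split; apply: eq_bigr => j _ /=; ring.
ring.
Qed.

Lemma bs_init_admissible : admissible (bs_init R n d.+1).
Proof.
split; [move=> i|move=> j|move=> j]; rewrite /entry /= mxE ?invr_gt0 ?ltr0n //.
lra.
Qed.

Lemma iterates A b c T k : (forall j, \sum_i `|A i j| <= 1) ->
  let z := iter k (bs_step A b c T) (bs_init R n d.+1) in
  [/\ admissible z,
      forall i, `|it_xhat z i 0| <= k%:R / T%:R,
      forall j, 0 <= it_yhat z j 0,
      \sum_j it_yhat z j 0 = k%:R / T%:R &
      forall u q, in_box u -> in_simplex q ->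
        6^-1 * weighted_gap A (entry b) (entry c) (k%:R / T%:R)
          (entry (it_xhat z)) (entry (it_yhat z)) u q
        <= T%:R^-1 * (potential A (bs_init R n d.+1) u q - potential A z u q)].
Proof.
move=> colA; elim: k => [|k] /=.
  split.
  - exact: bs_init_admissible.
  - by move=> i; rewrite mxE normr0 mul0r.
  - by move=> j; rewrite mxE.
  - by rewrite mul0r big1 // => j _; rewrite mxE.
  - move=> u q _ _; rewrite mul0r subrr mulr0.
    rewrite (_ : entry 0 = fun=> 0); last by apply/funext => i; rewrite /entry mxE.
    rewrite (_ : entry 0 = fun=> 0); last by apply/funext => i; rewrite /entry mxE.
    by rewrite weighted_gap0 mulr0.
set z := iter _ _ _ => -[adm xh yh0 yh1 gap].
have [adm1 [x' [y' [ex ey bx' sy' prog]]]] :=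
  @bs_step_progress R n d A b c T z colA adm _ erefl.
set z1 := bs_step _ _ _ _ z in adm1 ex ey prog *.
have T0 : 0 <= (T%:R^-1 : R) by rewrite invr_ge0.
have ek : k.+1%:R / T%:R = k%:R / T%:R + T%:R^-1 :> R.
  by rewrite -natr1 mulrDl mul1r.
split=> //.
- move=> i; rewrite ex !entryE ek; apply: le_trans (ler_normD _ _) _; apply: lerD => //.
  by rewrite normrM ger0_norm // ler_piMr // ler_norml; exact: bx'.
- move=> j; rewrite ey !entryE addr_ge0 // mulr_ge0 //; exact: sy'.1.
- transitivity (\sum_j it_yhat z j 0 + \sum_j T%:R^-1 * entry y' j).
    by rewrite ey -big_split; apply: eq_bigr => j _; rewrite !entryE.
  by rewrite -mulr_sumr sy'.2 mulr1 yh1 ek.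
- move=> u q bu sq; rewrite ek.
  have -> : entry (it_xhat z1) = fun i => entry (it_xhat z) i + T%:R^-1 * entry x' i.
    by apply/funext => i; rewrite ex /entry !entryE.
  have -> : entry (it_yhat z1) = fun i => entry (it_yhat z) i + T%:R^-1 * entry y' i.
    by apply/funext => i; rewrite ey /entry !entryE.
  rewrite weighted_gap_add.
  have := gap u q bu sq; have := ler_wpM2l T0 (prog u q bu sq).
  lra.
Qed.

Lemma potential_init A u q : (forall j, \sum_i `|A i j| <= 1) ->
  in_box u -> in_simplex q ->
  potential A (bs_init R n d.+1) u q <= 8 * ln d.+1%:R + 1.
Proof.
move=> colA bu sq; rewrite /potential /bregman.
have -> : entry (it_y (bs_init R n d.+1)) = fun=> d.+1%:R^-1.
  by apply/funext => j; rewrite /entry /= mxE.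
have := KL_uniform sq.
suff : area_bregman (fun i j => `|A i j|) (entry (it_x (bs_init R n d.+1)))
   (fun=> d.+1%:R^-1) u q <= 1 by lra.
rewrite -[X in _ <= X](sq.2).
apply: le_trans (weighted_sum_le (a := fun i j => `|A i j|) colA (proj1 sq)).
apply: ler_sum => i _; apply: ler_sum => j _; apply: ler_wpM2l => //.
rewrite /entry_bregman /entry /= mxE mulr0 !mul0r subr0 addr0 ler_piMr ?(proj1 sq) //.
have /andP[u1 u2] := bu i.
have : 0 <= (1 - u i) * (1 + u i) by apply: mulr_ge0; lra.
lra.
Qed.

Lemma final_gap A b c T : (0 < T)%N -> (forall j, \sum_i `|A i j| <= 1) ->
  let z := iter T (bs_step A b c T) (bs_init R n d.+1) in
  [/\ in_box (entry (it_xhat z)), in_simplex (entry (it_yhat z)) &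
      forall u q, in_box u -> in_simplex q ->
        game A (entry b) (entry c) (entry (it_xhat z)) q
          - game A (entry b) (entry c) u (entry (it_yhat z))
        <= 6 * (8 * ln d.+1%:R + 1) / T%:R].
Proof.
move=> T0 colA z.
have [adm xh yh0 yh1 gap] := @iterates A b c T T colA.
have TT : T%:R / T%:R = 1 :> R by rewrite divff // pnatr_eq0 -lt0n.
rewrite -/z TT in adm xh yh0 yh1 gap.
have T1 : 0 <= (T%:R^-1 : R) by rewrite invr_ge0.
split; [by move=> i; rewrite -ler_norml; exact: xh | by split | ].
move=> u q bu sq; have := gap u q bu sq; rewrite weighted_gap1.
have p0 : 0 <= potential A z u q.
  have [h1 h2 h3] := adm; rewrite /potential addr_ge0 //.
    apply: bregman_ge0 => //; [by lra | exact: (proj1 sq)].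
  by rewrite mulr_ge0 // KL_ge0 //; exact: (proj1 sq).
have p1 := potential_init colA bu sq.
have : T%:R^-1 * (potential A (bs_init R n d.+1) u q - potential A z u q)
   <= T%:R^-1 * (8 * ln d.+1%:R + 1) by apply: ler_wpM2l => //; lra.
lra.
Qed.
End Convergence.

Section OperatorNorm.
Variables (R : realType) (n d : nat) (A : 'M[R]_(n, d)).

Lemma l1norm_mulmx_le (v : 'cV[R]_d) (M : R) : (forall j, \sum_i `|A i j| <= M) ->
  l1norm (A *m v) <= M * l1norm v.
Proof.
move=> hM; apply: (@le_trans _ _ (\sum_i \sum_j `|A i j| * `|v j 0|)).
  apply: ler_sum => i _; rewrite mxE; apply: le_trans (ler_norm_sum _ _ _) _.
  by apply: ler_sum => j _; rewrite normrM.
rewrite exchange_big mulr_sumr; apply: ler_sum => j _ /=.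
by rewrite -mulr_suml ler_wpM2r.
Qed.

Lemma l1norm_delta (j : 'I_d) : l1norm (delta_mx j 0 : 'cV[R]_d) = 1.
Proof.
rewrite /l1norm (bigD1 j) //= mxE !eqxx normr1 big1 ?addr0 // => i ij.
by rewrite mxE (negbTE ij) normr0.
Qed.

(** The supremum bounds the value at a basis vector, which is a column sum. *)
Lemma colsum_le_opnorm j : \sum_i `|A i j| <= opnorm11 A.
Proof.
have -> : \sum_i `|A i j| = l1norm (A *m delta_mx j 0).
  rewrite /l1norm; apply: eq_bigr => i _; rewrite -colE mxE.
  by [].
apply: ub_le_sup; last by exists (delta_mx j 0) => //; exact: l1norm_delta.
exists (\sum_j \sum_i `|A i j|) => _ [v /= v1 <-].
apply: le_trans (@l1norm_mulmx_le v (\sum_j \sum_i `|A i j|) _) _.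
  move=> k; rewrite [leRHS](bigD1 k) //= lerDl; apply: sumr_ge0 => l _.
  exact: sumr_ge0.
by rewrite v1 mulr1.
Qed.

Lemma opnorm_le_colsum (M : R) : (0 < d)%N -> (forall j, \sum_i `|A i j| <= M) ->
  opnorm11 A <= M.
Proof.
move=> d0 hM; apply: ge_sup.
  by exists (l1norm (A *m delta_mx (Ordinal d0) 0)), (delta_mx (Ordinal d0) 0) => //;
    exact: l1norm_delta.
move=> _ [v /= v1 <-]; apply: le_trans (l1norm_mulmx_le v hM) _.
by rewrite v1 mulr1.
Qed.
End OperatorNorm.

Section Saddle.
Variables (R : realType) (n d : nat).
Implicit Types (A : 'M[R]_(n, d.+1)) (b : 'cV[R]_d.+1) (c : 'cV[R]_n).

Lemma payoffE A b c x y :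
  payoff A b c x y = game A (entry b) (entry c) (entry x) (entry y).
Proof.
rewrite /payoff /game; congr (_ - _ + _).
- rewrite mxE; under eq_bigr => j _ do rewrite mxE mulr_suml.
  rewrite exchange_big; apply: eq_bigr => i _; apply: eq_bigr => j _ /=.
  by rewrite mxE /entry; ring.
- by rewrite mxE; apply: eq_bigr => j _; rewrite mxE.
- by rewrite mxE; apply: eq_bigr => j _; rewrite mxE.
Qed.

Lemma game_scale (s : R) A b c x y :
  game (s *: A) (entry (s *: b)) (entry (s *: c)) x y =
  s * game A (entry b) (entry c) x y.
Proof.
rewrite /game mulrDr mulrBr !mulr_sumr; congr (_ - _ + _); apply: eq_bigr => i _.
- by rewrite mulr_sumr; apply: eq_bigr => j _; rewrite mxE; ring.
- by rewrite /entry mxE mulrA.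
- by rewrite /entry mxE mulrA.
Qed.

Lemma in_simplexP (y : 'cV[R]_d.+1) : in_simplex (entry y) <-> simplex y.
Proof.
split=> -[y0 y1]; split=> //.
  by rewrite /l1norm -[RHS]y1; apply: eq_bigr => j _; rewrite ger0_norm //; exact: y0.
by rewrite -[RHS]y1; apply: eq_bigr => j _; rewrite ger0_norm //; exact: y0.
Qed.

Lemma saddle_of_gap A b c (eps : R) x y : in_box (entry x) -> in_simplex (entry y) ->
  (forall u q, in_box (entry u) -> in_simplex (entry q) ->
    payoff A b c x q - payoff A b c u y <= eps) ->
  approx_saddle A b c eps x y.
Proof.
move=> bx sy gap; split; [exact: bx | exact/in_simplexP | ].
rewrite lerBlDl -lerBlDr; apply: lb_le_inf.
  by exists (payoff A b c x y), x.
move=> _ [u bu <-]; rewrite lerBlDl; apply: ge_sup.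
  by exists (payoff A b c x y), y => //; exact/in_simplexP.
by move=> _ [q /in_simplexP sq <-]; rewrite -lerBlDr; exact: gap.
Qed.

Lemma bs_T_bounds A (eps : R) : 0 < eps < opnorm11 A ->
  [/\ (0 < bs_T A eps)%N,
   6 * (8 * ln d.+1%:R + 1) * opnorm11 A / eps <= (bs_T A eps)%:R &
   (bs_T A eps)%:R < 6 * (8 * ln d.+1%:R + 1) * opnorm11 A / eps + 1].
Proof.
move=> /andP[e0 eA]; rewrite /bs_T; set X := _ / eps.
have X0 : 0 < X.
  rewrite divr_gt0 // mulr_gt0 //; last exact: lt_trans eA.
  have : 0 <= ln (d.+1%:R : R) by apply: ln_ge0; rewrite ler1n.
  lra.
have c0 : 0 < Num.ceil X by rewrite ceil_gt0.
have e : (`|Num.ceil X|%N)%:R = (Num.ceil X)%:~R :> R.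
  by rewrite natr_absz gtr0_norm.
split; first by rewrite absz_gt0 gt_eqF.
  by rewrite e ceil_ge.
by rewrite e -ltrBlDr; have /andP[] := ceil_itv X; rewrite intrD.
Qed.

Lemma box_simplex_correct A b c (eps : R) : 0 < eps < opnorm11 A ->
  let xy := box_simplex A b c eps in approx_saddle A b c eps xy.1 xy.2.
Proof.
move=> he; have [T0 TX _] := bs_T_bounds he; move: (he) => /andP[e0 eA].
rewrite /box_simplex; set L := opnorm11 A in eA TX *; set T := bs_T A eps in T0 TX *.
have L0 : 0 < L by exact: lt_trans eA.
have colA j : \sum_i `|(L^-1 *: A) i j| <= 1.
  under eq_bigr => i _ do rewrite mxE normrM gtr0_norm ?invr_gt0 //.
  by rewrite -mulr_sumr mulrC ler_pdivrMr // mul1r colsum_le_opnorm.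
have [bx sy gap] := final_gap (L^-1 *: b) (L^-1 *: c) T0 colA.
apply: saddle_of_gap => // u q bu sq.
have := gap _ _ bu sq; rewrite !game_scale -!payoffE -mulrBr mulrC ler_pdivrMr //.
move=> h; apply: le_trans h _; rewrite mulrAC ler_pdivrMr ?ltr0n //.
by rewrite -ler_pdivrMl // mulrC.
Qed.
End Saddle.

(** * Vector programs and their compilation *)

(** Expressions for one position of an array, evaluated for all positions by the
same loop. The index of the loop is integer register 3. *)
Inductive vexp : Type :=
| VConst of nat
| VReg of nat
| VArr of nat                   (* array name; the position is the loop index *)
| VAdd of vexp & vexp
| VSub of vexp & vexp
| VMul of vexp & vexp
| VDiv of vexp & vexp
| VExp of vexp
| VLn of vexp.

Inductive vtree : Type :=
| VLeaf of vexp
| VTest of vexp & vexp & vtree & vtree.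

Fixpoint vexp_arrays (P : pred nat) (e : vexp) : bool :=
  match e with
  | VConst _ | VReg _ => true
  | VArr a => P a
  | VAdd e1 e2 | VSub e1 e2 | VMul e1 e2 | VDiv e1 e2 =>
      vexp_arrays P e1 && vexp_arrays P e2
  | VExp e1 | VLn e1 => vexp_arrays P e1
  end.

Fixpoint vtree_arrays (P : pred nat) (e : vtree) : bool :=
  match e with
  | VLeaf e1 => vexp_arrays P e1
  | VTest e1 e2 f1 f2 =>
      [&& vexp_arrays P e1, vexp_arrays P e2, vtree_arrays P f1 & vtree_arrays P f2]
  end.

Fixpoint rexp_of (arr : nat -> rexp) (e : vexp) : rexp :=
  match e with
  | VConst k => RConst k
  | VReg r => RReg r
  | VArr a => arr a
  | VAdd e1 e2 => RAdd (rexp_of arr e1) (rexp_of arr e2)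
  | VSub e1 e2 => RSub (rexp_of arr e1) (rexp_of arr e2)
  | VMul e1 e2 => RMul (rexp_of arr e1) (rexp_of arr e2)
  | VDiv e1 e2 => RDiv (rexp_of arr e1) (rexp_of arr e2)
  | VExp e1 => RExp (rexp_of arr e1)
  | VLn e1 => RLn (rexp_of arr e1)
  end.

Definition at_index (a : nat) : rexp := RGet a (IReg 3).
(** Outside loops there is no current position, and arrays read as zero. *)
Definition no_array (a : nat) : rexp := RConst 0.

Section Evaluation.
Variable R : realType.

Fixpoint veval (S arr : nat -> R) (e : vexp) : R :=
  match e with
  | VConst k => k%:R
  | VReg r => S r
  | VArr a => arr a
  | VAdd e1 e2 => veval S arr e1 + veval S arr e2
  | VSub e1 e2 => veval S arr e1 - veval S arr e2
  | VMul e1 e2 => veval S arr e1 * veval S arr e2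
  | VDiv e1 e2 => veval S arr e1 / veval S arr e2
  | VExp e1 => expR (veval S arr e1)
  | VLn e1 => ln (veval S arr e1)
  end.

Fixpoint teval (S arr : nat -> R) (e : vtree) : R :=
  match e with
  | VLeaf e1 => veval S arr e1
  | VTest e1 e2 f1 f2 =>
      if veval S arr e1 < veval S arr e2 then teval S arr f1 else teval S arr f2
  end.

Lemma reval_at_index (s : state R) e :
  reval s (rexp_of at_index e) = veval (rreg s) (fun a => rarr s a (ireg s 3)) e.
Proof. by elim: e => //= [e1 -> e2 ->|e1 -> e2 ->|e1 -> e2 ->|e1 -> e2 ->|e1 ->|e1 ->]. Qed.

Lemma reval_no_array (s : state R) e :
  reval s (rexp_of no_array e) = veval (rreg s) (fun=> 0) e.
Proof. by elim: e => //= [e1 -> e2 ->|e1 -> e2 ->|e1 -> e2 ->|e1 -> e2 ->|e1 ->|e1 ->]. Qed.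

Lemma eq_veval (S S' arr arr' : nat -> R) (P : pred nat) e :
  S =1 S' -> (forall a, P a -> arr a = arr' a) -> vexp_arrays P e ->
  veval S arr e = veval S' arr' e.
Proof.
move=> eS ea; elim: e => //=.
- by move=> e1 IH1 e2 IH2 /andP[h1 h2]; rewrite IH1 // IH2.
- by move=> e1 IH1 e2 IH2 /andP[h1 h2]; rewrite IH1 // IH2.
- by move=> e1 IH1 e2 IH2 /andP[h1 h2]; rewrite IH1 // IH2.
- by move=> e1 IH1 e2 IH2 /andP[h1 h2]; rewrite IH1 // IH2.
- by move=> e1 IH h; rewrite IH.
- by move=> e1 IH h; rewrite IH.
Qed.

Lemma eq_teval (S S' arr arr' : nat -> R) (P : pred nat) e :
  S =1 S' -> (forall a, P a -> arr a = arr' a) -> vtree_arrays P e ->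
  teval S arr e = teval S' arr' e.
Proof.
move=> eS ea; elim: e => //= [e|e1 e2 f1 IH1 f2 IH2]; first exact: eq_veval.
move=> /and4P[h1 h2 h3 h4]; rewrite IH1 // IH2 //.
by rewrite (eq_veval eS ea h1) (eq_veval eS ea h2).
Qed.
End Evaluation.

Section Commands.
Variables (O : Type).

Fixpoint put_tree (dst : nat) (e : vtree) : cmd O :=
  match e with
  | VLeaf e1 => RPut O dst (IReg 3) (rexp_of at_index e1)
  | VTest e1 e2 f1 f2 =>
      If (RLt (rexp_of at_index e1) (rexp_of at_index e2))
         (put_tree dst f1) (put_tree dst f2)
  end.

Fixpoint tree_cost (e : vtree) : nat :=
  match e with
  | VLeaf e1 => (rcost (rexp_of at_index e1)).+2
  | VTest e1 e2 f1 f2 =>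
      (rcost (rexp_of at_index e1) + rcost (rexp_of at_index e2)).+2
      + tree_cost f1 + tree_cost f2
  end.

Definition for_loop (len : nat) (body : cmd O) : cmd O :=
  Seq (ISet O 3 (IConst 0))
      (While (ILt (IReg 3) (IReg len))
             (Seq body (ISet O 3 (IAdd (IReg 3) (IConst 1))))).

Variables (R : realType) (sub : O -> mv_subroutine R).

Lemma exec_put_tree dst e s : exists2 t, (t <= tree_cost e)%N &
  exec sub (put_tree dst e) s t
    (set_rarr s dst (ireg s 3) (teval (rreg s) (fun a => rarr s a (ireg s 3)) e)).
Proof.
elim: e => /= [e|e1 e2 f1 [t1 h1 x1] f2 [t2 h2 x2]].
  by exists (1 + rcost (rexp_of at_index e)).+1 => //; rewrite -reval_at_index; constructor.
rewrite -!reval_at_index; case: ifPn => h.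
  exists ((rcost (rexp_of at_index e1) + rcost (rexp_of at_index e2)).+2 + t1)%N.
    by rewrite -addnA leq_add2l (leq_trans h1) // leq_addr.
  by apply: ExecIfTrue.
exists ((rcost (rexp_of at_index e1) + rcost (rexp_of at_index e2)).+2 + t2)%N.
  by rewrite -addnA leq_add2l (leq_trans h2) // leq_addl.
by apply: ExecIfFalse.
Qed.

Lemma exec_for_loop len body (I : nat -> state R -> Prop) K m s :
  ireg s len = m -> len != 3%N -> I 0%N (set_ireg s 3 0) ->
  (forall k s1, (k < m)%N -> ireg s1 len = m -> ireg s1 3 = k -> I k s1 ->
    exists t s2, [/\ exec sub body s1 t s2, (t <= K)%N, ireg s2 len = m,
      ireg s2 3 = k & I k.+1 (set_ireg s2 3 k.+1)]) ->
  exists t s', [/\ exec sub (for_loop len body) s t s',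
    (t <= m * (K + 8) + 6)%N & I m s'].
Proof.
move=> hm h3 I0 step.
suff loop j s1 : (j <= m)%N -> ireg s1 len = m -> ireg s1 3 = (m - j)%N -> I (m - j)%N s1 ->
    exists t s', [/\ exec sub (While (ILt (IReg 3) (IReg len))
             (Seq body (ISet O 3 (IAdd (IReg 3) (IConst 1))))) s1 t s',
    (t <= j * (K + 8) + 4)%N & I m s'].
  have [||||t [s' [x ht Im]]] := loop m (set_ireg s 3 0) => //.
  - by rewrite /= /upd (negbTE h3).
  - by rewrite subnn.
  - by rewrite subnn.
  exists (2 + t)%N, s'; split=> //; last by rewrite (_ : 6 = 2 + 4)%N // addnCA leq_add2l.
  by apply: ExecSeq x; exact: (ExecISet sub 3 (IConst 0) s).
elim: j s1 => [|j IH] s1 jm hl e3 Ij.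
  exists 4%N, s1; rewrite subn0 in Ij; split=> //.
  apply: (@ExecWhileFalse _ _ sub (ILt (IReg 3) (IReg len))).
  by rewrite /= e3 hl subn0 ltnn.
have km : (m - j.+1 < m)%N by lia.
have [t [s2 [x ht hl2 e32 I2]]] := step _ _ km hl e3 Ij.
have ek : (m - j.+1).+1 = (m - j)%N by lia.
rewrite ek in I2.
have [||||t' [s' [x' ht' Im]]] := IH (set_ireg s2 3 (m - j)) => //.
- exact: ltnW.
- by rewrite /= /upd (negbTE h3).
exists (4 + (t + 4) + t')%N, s'; split=> //; last by lia.
apply: (@ExecWhileTrue _ _ sub (ILt (IReg 3) (IReg len))) x'.
  by rewrite /= e3 hl.
apply: ExecSeq x _.
have -> : (m - j = ireg s2 3 + 1)%N by rewrite e32 addn1 ek.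
exact: (ExecISet sub 3 (IAdd (IReg 3) (IConst 1)) s2).
Qed.

Definition map_loop (len dst : nat) (e : vtree) : cmd O :=
  for_loop len (put_tree dst e).

(** An entrywise update may read its own target, since position i is read only
before it is written. *)
Lemma exec_map_loop len dst e m s : ireg s len = m -> len != 3%N ->
  exists t s', [/\ exec sub (map_loop len dst e) s t s',
    (t <= m * (tree_cost e + 8) + 6)%N,
    forall r, r != 3%N -> ireg s' r = ireg s r, iarr s' = iarr s & rreg s' = rreg s /\
    forall a i, rarr s' a i = if (a == dst) && (i < m)%N
      then teval (rreg s) (fun a => rarr s a i) e else rarr s a i].
Proof.
move=> hm h3.
pose I k (s' : state R) := [/\ forall r, r != 3%N -> ireg s' r = ireg s r,
  iarr s' = iarr s, rreg s' = rreg s &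
    forall a i, rarr s' a i = if (a == dst) && (i < k)%N
      then teval (rreg s) (fun a => rarr s a i) e else rarr s a i].
have [|k s1 km hl e3 [i1 i2 i3 i4]|t [s' [x ht [h1 h2 h4 h5]]]] :=
  @exec_for_loop len (put_tree dst e) I (tree_cost e) m s hm h3.
- split=> //= [r hr|a i]; first by rewrite /upd (negbTE hr).
  by rewrite ltn0 andbF.
- have [t ht x] := exec_put_tree dst e s1.
  exists t, (set_rarr s1 dst (ireg s1 3) (teval (rreg s1) (fun a => rarr s1 a (ireg s1 3)) e)).
  split=> //; split=> //=.
  + by move=> r hr; rewrite /upd (negbTE hr) i1.
  + move=> a i; rewrite /upd e3 i3; case: (eqVneq a dst) => [->|ad] /=; last by rewrite i4 (negbTE ad).
    rewrite ltnS leq_eqVlt; case: (eqVneq i k) => [->|_] /=; last by rewrite i4 eqxx.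
    congr teval; apply/funext => b; by rewrite i4 ltnn andbF.
- by exists t, s'.
Qed.

Definition sum_loop (len r a : nat) : cmd O :=
  Seq (RSet O r (RConst 0)) (for_loop len (RSet O r (RAdd (RReg r) (at_index a)))).

Definition max_loop (len r a : nat) : cmd O :=
  Seq (RSet O r (RConst 0))
    (for_loop len (If (RLt (RReg r) (at_index a)) (RSet O r (at_index a)) (Skip O))).

(** The loops for sums and for maxima, 12 being a bound for the cost of a single
update in both cases. *)
Lemma exec_fold_loop len r a m s (body : cmd O) (op : R -> R -> R) :
  ireg s len = m -> len != 3%N ->
  (forall s1, exists t, [/\ (t <= 12)%N &
     exec sub body s1 t (set_rreg s1 r (op (rreg s1 r) (rarr s1 a (ireg s1 3))))]) ->
  exists t s', [/\ exec sub (Seq (RSet O r (RConst 0)) (for_loop len body)) s t s',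
    (t <= m * 20 + 8)%N,
    forall k, k != 3%N -> ireg s' k = ireg s k, iarr s' = iarr s & rarr s' = rarr s /\
    forall k, rreg s' k = if k == r
      then iteri m (fun j x => op x (rarr s a j)) 0 else rreg s k].
Proof.
move=> hm h3 xb.
pose s0 := set_rreg s r 0.
pose I j (s' : state R) := [/\ forall k, k != 3%N -> ireg s' k = ireg s k,
  iarr s' = iarr s, rarr s' = rarr s &
    forall k, rreg s' k = if k == r
      then iteri j (fun j x => op x (rarr s a j)) 0 else rreg s k].
have [|j s1 jm hl e3 [i1 i2 i3 i4]|t [s' [x ht [h1 h2 h4 h5]]]] :=
  @exec_for_loop len body I 12 m s0 hm h3.
- split=> //= k hk; by rewrite /upd (negbTE hk).
- have [t [ht x]] := xb s1.
  exists t, (set_rreg s1 r (op (rreg s1 r) (rarr s1 a (ireg s1 3)))).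
  split=> //; split=> //= [k hk|k].
    by rewrite /upd (negbTE hk) i1.
  rewrite /upd e3 i3 i4 eqxx; case: eqP => // /eqP kr; by rewrite i4 (negbTE kr).
- exists (2 + t)%N, s'; split=> //; last by lia.
  by apply: ExecSeq x; exact: (ExecRSet sub r (RConst 0) s).
Qed.

Lemma iteri_sum (f : nat -> R) m :
  iteri m (fun j x => x + f j) 0 = \sum_(j < m) f j.
Proof. by elim: m => [|m IH]; rewrite ?big_ord0 // big_ord_recr /= IH. Qed.

Lemma iteri_max_ge (f : nat -> R) m j : (j < m)%N ->
  f j <= iteri m (fun j x => Num.max x (f j)) 0.
Proof.
elim: m => // m IH; rewrite ltnS leq_eqVlt le_max /=.
by case/predU1P => [->|/IH ->]; rewrite ?lexx ?orbT.
Qed.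

Lemma iteri_max_le (f : nat -> R) m M : 0 <= M -> (forall j, (j < m)%N -> f j <= M) ->
  iteri m (fun j x => Num.max x (f j)) 0 <= M.
Proof.
move=> M0; elim: m => //= m IH h; rewrite ge_max h // andbT IH // => j jm.
by apply: h; rewrite ltnS ltnW.
Qed.

Lemma exec_sum_step r a s1 : exists t, [/\ (t <= 12)%N &
  exec sub (RSet O r (RAdd (RReg r) (at_index a))) s1 t
   (set_rreg s1 r (rreg s1 r + rarr s1 a (ireg s1 3)))].
Proof. by exists 5%N; split=> //; exact: (ExecRSet sub r (RAdd (RReg r) (at_index a)) s1). Qed.

Lemma set_rreg_self (s1 : state R) r : set_rreg s1 r (rreg s1 r) = s1.
Proof.
case: s1 => ir ia rr ra; rewrite /set_rreg /=; congr State; apply/funext => k.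
by rewrite /upd; case: eqP => // ->.
Qed.

Lemma exec_max_step r a s1 : exists t, [/\ (t <= 12)%N &
  exec sub (If (RLt (RReg r) (at_index a)) (RSet O r (at_index a)) (Skip O)) s1 t
   (set_rreg s1 r (Num.max (rreg s1 r) (rarr s1 a (ireg s1 3))))].
Proof.
rewrite maxElt; case: ifP => h.
  exists (5 + 3)%N; split=> //.
  apply: (@ExecIfTrue _ _ sub (RLt (RReg r) (at_index a))) => //.
  exact: (ExecRSet sub r (at_index a) s1).
exists (5 + 1)%N; split=> //; rewrite set_rreg_self.
by apply: (@ExecIfFalse _ _ sub (RLt (RReg r) (at_index a))); rewrite /= ?h //; constructor.
Qed.
End Commands.

(** NMap and MulN write a vector of length n, DMap and MulD one of length d. The
boolean of a product selects |A| instead of A, and MulD multiplies by the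
transpose. *)
Inductive instr : Type :=
| NMap of nat & vtree
| DMap of nat & vtree
| MulN of bool & nat & nat      (* target, source *)
| MulD of bool & nat & nat
| Assign of nat & vexp
| DSum of nat & nat
| DMax of nat & nat.

(** Arrays with odd names hold vectors indexed by the rows of the matrix, those
with even names vectors indexed by its columns; array 2 is kept for the list of
entries. *)
Definition is_rowvec (a : nat) : bool := odd a.
Definition is_colvec (a : nat) : bool := ~~ odd a && (a != 2%N).

Definition well_formed (i : instr) : bool :=
  match i with
  | NMap dst e => is_rowvec dst && vtree_arrays is_rowvec e
  | DMap dst e => is_colvec dst && vtree_arrays is_colvec e
  | MulN _ dst src => is_rowvec dst && is_colvec src
  | MulD _ dst src => is_colvec dst && is_rowvec src
  | Assign _ _ => true
  | DSum _ a | DMax _ a => is_colvec a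
  end.

Definition mulN_name (abs : bool) : mv_name := if abs then MvAbs else MvA.
Definition mulD_name (abs : bool) : mv_name := if abs then MvAbsT else MvAT.

Section Compile.
Variables (O : Type) (mvc : mv_name -> nat -> nat -> cmd O).

Definition compile (i : instr) : cmd O :=
  match i with
  | NMap dst e => map_loop O 0 dst e
  | DMap dst e => map_loop O 1 dst e
  | MulN abs dst src => mvc (mulN_name abs) src dst
  | MulD abs dst src => mvc (mulD_name abs) src dst
  | Assign r e => RSet O r (rexp_of no_array e)
  | DSum r a => sum_loop O 1 r a
  | DMax r a => max_loop O 1 r a
  end.

Definition compile_seq (l : seq instr) : cmd O :=
  foldr (fun i p => Seq (compile i) p) (Skip O) l.
End Compile.

Definition instr_cost (Kmv : nat) (i : instr) : nat :=
  match i with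
  | NMap _ e | DMap _ e => tree_cost e + 14
  | MulN _ _ _ | MulD _ _ _ => Kmv
  | Assign _ e => (rcost (rexp_of no_array e)).+1
  | DSum _ _ | DMax _ _ => 28
  end.

(** In multiples of the bound M of [simulation]. *)
Definition seq_cost (Kmv : nat) (l : seq instr) : nat :=
  foldr (fun i k => instr_cost Kmv i + k) 1 l.

Record vstate (R : realType) (n d : nat) := VState {
  rowvec : nat -> 'cV[R]_n;
  colvec : nat -> 'cV[R]_d;
  scalar : nat -> R }.

Section Denotation.
Variables (R : realType) (n d : nat) (A : 'M[R]_(n, d)).
Implicit Types (v : vstate R n d) (s : state R).

Definition mulN_mx (abs : bool) : 'M[R]_(n, d) := if abs then absmx A else A.
Definition mulD_mx (abs : bool) : 'M[R]_(d, n) :=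
  if abs then (absmx A)^T else A^T.

Definition set_rowvec v a w := VState (upd (rowvec v) a w) (colvec v) (scalar v).
Definition set_colvec v a w := VState (rowvec v) (upd (colvec v) a w) (scalar v).
Definition set_scalar v r x := VState (rowvec v) (colvec v) (upd (scalar v) r x).

Definition denote (i : instr) v : vstate R n d :=
  match i with
  | NMap dst e => set_rowvec v dst
      (\col_i teval (scalar v) (fun a => rowvec v a i 0) e)
  | DMap dst e => set_colvec v dst
      (\col_i teval (scalar v) (fun a => colvec v a i 0) e)
  | MulN abs dst src => set_rowvec v dst (mulN_mx abs *m colvec v src)
  | MulD abs dst src => set_colvec v dst (mulD_mx abs *m rowvec v src)
  | Assign r e => set_scalar v r (veval (scalar v) (fun=> 0) e)
  | DSum r a => set_scalar v r (\sum_j colvec v a j 0)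
  | DMax r a => set_scalar v r (\big[Num.max/0]_j colvec v a j 0)
  end.

Definition denote_seq (l : seq instr) v : vstate R n d :=
  foldl (fun v i => denote i v) v l.

Variable s0 : state R.

(** What every instruction preserves: the dimensions and the list of entries of the
matrix, as they are in the initial state. *)
Definition frame s : Prop :=
  [/\ ireg s 0 = n, ireg s 1 = d, ireg s 2 = ireg s0 2, iarr s = iarr s0 &
      forall i, rarr s 2 i = rarr s0 2 i].

Definition represents s v : Prop :=
  [/\ frame s, forall r, rreg s r = scalar v r,
      forall a, is_rowvec a -> holds_vec s a (rowvec v a) &
      forall a, is_colvec a -> holds_vec s a (colvec v a)].

Variables (O : Type) (sub : O -> mv_subroutine R).
Variables (mvc : mv_name -> nat -> nat -> cmd O) (Kmv M : nat).

(** The interface between the program and the form of access to the matrix. *)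
Definition multiplies (p : nat) (q : nat) (B : 'M[R]_(p, q)) (c : cmd O) (src dst : nat) :=
  forall s, frame s -> exists t s', [/\ exec sub c s t s', (t <= Kmv * M)%N,
    frame s', rreg s' = rreg s &
    (forall a, a != dst -> forall i, rarr s' a i = rarr s a i) /\
    forall v : 'cV_q, holds_vec s src v -> holds_vec s' dst (B *m v)].

Hypothesis mulN_ok : forall abs dst src, is_rowvec dst -> is_colvec src ->
  multiplies (mulN_mx abs) (mvc (mulN_name abs) src dst) src dst.
Hypothesis mulD_ok : forall abs dst src, is_colvec dst -> is_rowvec src ->
  multiplies (mulD_mx abs) (mvc (mulD_name abs) src dst) src dst.
Hypotheses (nM : (n <= M)%N) (dM : (d <= M)%N) (M1 : (0 < M)%N).

Lemma rowvec_not_colvec a : is_rowvec a -> is_colvec a = false.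
Proof. by rewrite /is_colvec /is_rowvec => ->. Qed.

Lemma colvec_not_rowvec a : is_colvec a -> is_rowvec a = false.
Proof. by rewrite /is_colvec /is_rowvec => /andP[/negbTE]. Qed.

Lemma rowvec_neq2 a : is_rowvec a -> (2%N == a) = false.
Proof. by move=> h; apply/eqP => e; rewrite -e in h. Qed.

Lemma colvec_neq2 a : is_colvec a -> (2%N == a) = false.
Proof. by move=> /andP[_ /negbTE]; rewrite eq_sym. Qed.

Lemma iteri_bigmax (f : nat -> R) m :
  iteri m (fun j x => Num.max x (f j)) 0 = \big[Num.max/0]_(j < m) f j.
Proof.
apply/eqP; rewrite eq_le; apply/andP; split.
  apply: iteri_max_le => [|j jm]; first exact: bigmax_ge_id.
  exact: (le_bigmax _ (fun j : 'I_m => f j) (Ordinal jm)).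
apply: bigmax_le => [|j _]; last exact: (iteri_max_ge f (ltn_ord j)).
by elim: m => //= m IH; rewrite le_max IH.
Qed.

(** Each instruction is a bounded number of passes over vectors of length at most
M, or one product. *)
Lemma simulation i v s : well_formed i -> represents s v ->
  exists t s', [/\ exec sub (compile mvc i) s t s', (t <= instr_cost Kmv i * M)%N &
    represents s' (denote i v)].
Proof.
move=> wf [fr es rv cv]; have [f0 f1 f2 f3 f4] := fr.
have cost k m : (m <= M)%N -> (m * k + 6 <= (k + 6) * M)%N by nia.
case: i wf => [dst e|dst e|abs dst src|abs dst src|r e|r a|r a] /=.
- move=> /andP[nd ne].
  have [t [s' [x ht h1 h2 [h3 h4]]]] := exec_map_loop sub dst e f0 isT.
  exists t, s'; split=> //.
    by apply: leq_trans ht _; rewrite (_ : 14 = 8 + 6)%N // addnA; exact: cost.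
  split=> //=.
  + split; rewrite ?h1 ?h2 //.
    by move=> i; rewrite h4 rowvec_neq2 //= f4.
  + by move=> r; rewrite h3.
  + move=> a na i; rewrite h4 /upd; case: eqP => [->|_] /=; last exact: rv.
    rewrite ltn_ord mxE; apply: eq_teval ne => // b nb; exact: rv.
  + move=> a da i; rewrite h4; case: eqP => [ea|_] /=; last exact: cv.
    by rewrite ea rowvec_not_colvec in da.
- move=> /andP[nd ne].
  have [t [s' [x ht h1 h2 [h3 h4]]]] := exec_map_loop sub dst e f1 isT.
  exists t, s'; split=> //.
    by apply: leq_trans ht _; rewrite (_ : 14 = 8 + 6)%N // addnA; exact: cost.
  split=> //=.
  + split; rewrite ?h1 ?h2 //.
    by move=> i; rewrite h4 colvec_neq2 //= f4.
  + by move=> r; rewrite h3.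
  + move=> a da i; rewrite h4; case: eqP => [ea|_] /=; last exact: rv.
    by rewrite ea colvec_not_rowvec in da.
  + move=> a na i; rewrite h4 /upd; case: eqP => [->|_] /=; last exact: cv.
    rewrite ltn_ord mxE; apply: eq_teval ne => // b nb; exact: cv.
- move=> /andP[nd ns].
  have [t [s' [x ht fr' h3 [h4 h5]]]] := mulN_ok abs nd ns fr.
  exists t, s'; split=> //; split=> //=.
  + by move=> r; rewrite h3.
  + move=> a na i; rewrite /upd; case: eqP => [->|/eqP ne]; last by rewrite h4 //; exact: rv.
    by apply: h5; exact: cv.
  + move=> a na i; rewrite h4; first exact: cv.
    by apply/eqP => ea; rewrite ea rowvec_not_colvec in na.
- move=> /andP[nd ns].
  have [t [s' [x ht fr' h3 [h4 h5]]]] := mulD_ok abs nd ns fr.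
  exists t, s'; split=> //; split=> //=.
  + by move=> r; rewrite h3.
  + move=> a na i; rewrite h4; first exact: rv.
    by apply/eqP => ea; rewrite ea colvec_not_rowvec in na.
  + move=> a na i; rewrite /upd; case: eqP => [->|/eqP ne]; last by rewrite h4 //; exact: cv.
    by apply: h5; exact: rv.
- move=> _; exists (rcost (rexp_of no_array e)).+1, (set_rreg s r (reval s (rexp_of no_array e))).
  split; [by constructor | by rewrite leq_pmulr | ].
  split=> //= k; rewrite /upd es reval_no_array.
  by case: eqP => // _; apply: (@eq_veval _ _ _ _ _ predT) => //; elim: (e) => //= ? -> ? ->.
- move=> da.
  have [t [s' [x ht h1 h2 [h3 h4]]]] := exec_fold_loop f1 isT (exec_sum_step sub r a).
  exists t, s'; split=> //; first by apply: leq_trans ht _; nia.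
  split=> //=.
  + by split; rewrite ?h1 ?h2 ?h3.
  + move=> k; rewrite h4 /upd es; case: eqP => // _; rewrite iteri_sum.
    by apply: eq_bigr => j _; exact: cv.
  + by move=> b nb i; rewrite h3; exact: rv.
  + by move=> b nb i; rewrite h3; exact: cv.
- move=> da.
  have [t [s' [x ht h1 h2 [h3 h4]]]] := exec_fold_loop f1 isT (exec_max_step sub r a).
  exists t, s'; split=> //; first by apply: leq_trans ht _; nia.
  split=> //=.
  + by split; rewrite ?h1 ?h2 ?h3.
  + move=> k; rewrite h4 /upd es; case: eqP => // _; rewrite iteri_bigmax.
    by apply: eq_bigr => j _; exact: cv.
  + by move=> b nb i; rewrite h3; exact: rv.
  + by move=> b nb i; rewrite h3; exact: cv.
Qed.

Lemma simulation_seq l v s : all well_formed l -> represents s v ->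
  exists t s', [/\ exec sub (compile_seq mvc l) s t s', (t <= seq_cost Kmv l * M)%N &
    represents s' (denote_seq l v)].
Proof.
elim: l v s => [|i l IH] v s /=.
  by move=> _ h; exists 1%N, s; split=> //; [constructor | rewrite mul1n].
move=> /andP[wi wl] h.
have [t [s1 [x ht h1]]] := simulation wi h.
have [t' [s2 [x' ht' h2]]] := IH _ _ wl h1.
exists (t + t')%N, s2; split=> //; first exact: ExecSeq x x'.
by rewrite mulnDl leq_add.
Qed.

Lemma simulation_while l r1 r2 m v s : all well_formed l -> represents s v ->
  (forall k, (k < m)%N ->
     scalar (iter k (denote_seq l) v) r1 < scalar (iter k (denote_seq l) v) r2) ->
  ~~ (scalar (iter m (denote_seq l) v) r1 < scalar (iter m (denote_seq l) v) r2) ->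
  exists t s', [/\ exec sub (While (RLt (RReg r1) (RReg r2)) (compile_seq mvc l)) s t s',
    (t <= (m * (seq_cost Kmv l + 4) + 4) * M)%N &
    represents s' (iter m (denote_seq l) v)].
Proof.
move=> wl; elim: m v s => [|m IH] v s rep lt stop.
  exists 4%N, s; split=> //; last by rewrite mul0n leq_pmulr.
  apply: (@ExecWhileFalse _ _ sub (RLt (RReg r1) (RReg r2))).
  by have [_ es _ _] := rep; rewrite /= !es.
have [t [s1 [x ht h1]]] := simulation_seq wl rep.
have [||t' [s2 [x' ht' h2]]] := IH (denote_seq l v) s1 h1.
- by move=> k km; rewrite -iterSr; exact: lt.
- by rewrite -iterSr.
exists (4 + t + t')%N, s2; split; last by rewrite iterSr.
  apply: (@ExecWhileTrue _ _ sub (RLt (RReg r1) (RReg r2))) x x'.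
  by have [_ es _ _] := rep; rewrite /= !es; exact: (lt 0%N).
nia.
Qed.
End Denotation.

(** * The program *)

(** Memory layout. Arrays of length n: 1 holds c, 3 xhat, 5 x, 7 the vector |A| y,
9 the gradient in x and then its shift, 11 the latest best response, 13 the
product of |A| with the weights in force, 15 squares. Arrays of length d: 0 holds
b, 4 yhat, 6 y, 8 ybar, 10 the gradient in y, 12 the vector |A|^T x^2, 14 first y'
and then the next y, 16 the product of |A|^T with squares and then the next ybar,
18 absolute values. Real registers: 0 holds eps, 1 the dimension d, 2 the norm L,
3 its inverse, 4 the real number whose ceiling is T, 5 holds T, 6 its inverse,
7 the loop counter, 8 an l1 norm. *)

(** Truncation of - p / q without infinite values: comparing p with q and - q
decides whether the quotient leaves [-1, 1], even for q = 0. In the remaining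
cases the division is correct, including 0 / 0 = 0. *)
Definition quot_tree (p q : vexp) : vtree :=
  let neg e := VSub (VConst 0) e in
  let inner := VLeaf (neg (VDiv p q)) in
  let one := VLeaf (VConst 1) in
  let minus_one := VLeaf (neg (VConst 1)) in
  VTest q (VConst 0)
    (VTest p q minus_one (VTest (neg q) p one inner))
    (VTest q p minus_one (VTest p (neg q) one inner)).

Definition scaled (e : vexp) : vexp := VMul (VReg 3) e.

Definition grad_rows (k src : nat) : seq instr :=
  [:: MulN false 9 src;
      NMap 9 (VLeaf (VMul (VDiv (VConst 1) (VConst k))
                          (VAdd (scaled (VArr 9)) (VArr 1))))].

Definition grad_cols (k src : nat) : seq instr :=
  [:: MulD false 10 src;
      DMap 10 (VLeaf (VMul (VDiv (VConst 1) (VConst k))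
                           (VSub (VArr 0) (scaled (VArr 10)))))].

Definition abs_mul (dst src : nat) : seq instr :=
  [:: MulN true dst src; NMap dst (VLeaf (scaled (VArr dst)))].

Definition abs_colsq (dst src : nat) : seq instr :=
  [:: NMap 15 (VLeaf (VMul (VArr src) (VArr src)));
      MulD true dst 15; DMap dst (VLeaf (scaled (VArr dst)))].

Definition shift_grad : seq instr :=
  [:: NMap 9 (VLeaf (VSub (VArr 9) (VMul (VConst 2) (VMul (VArr 5) (VArr 7)))))].

Definition best_response (dst den : nat) : seq instr :=
  [:: NMap dst (quot_tree (VArr 9) (VMul (VConst 2) (VArr den)))].

Definition mirror_step (dst src be : nat) (w : vexp) : seq instr :=
  [:: DMap dst (VLeaf (VMul (VArr src)
        (VExp (VMul (VSub (VConst 0) (VDiv (VConst 1) (VConst be))) w))));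
      DMap 18 (VTest (VArr dst) (VConst 0)
        (VLeaf (VSub (VConst 0) (VArr dst))) (VLeaf (VArr dst)));
      DSum 8 18;
      DMap dst (VLeaf (VMul (VDiv (VConst 1) (VReg 8)) (VArr dst)))].

Definition add_to_average : seq instr :=
  [:: NMap 3 (VLeaf (VAdd (VArr 3) (VMul (VReg 6) (VArr 11))));
      DMap 4 (VLeaf (VAdd (VArr 4) (VMul (VReg 6) (VArr 14))))].

Definition entropy_shift (y : nat) : vexp :=
  VSub (VSub (VAdd (VAdd (VArr 10) (VArr 16)) (VMul (VConst 4) (VLn (VArr y))))
             (VArr 12))
       (VMul (VConst 4) (VLn (VArr 6))).

Definition store_iterate : seq instr :=
  [:: NMap 5 (VLeaf (VArr 11)); DMap 6 (VLeaf (VArr 14)); DMap 8 (VLeaf (VArr 16))].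

Definition loop_body : seq instr :=
  grad_rows 3 6 ++ grad_cols 3 5 ++ abs_mul 7 6 ++ abs_colsq 12 5 ++ shift_grad ++
  best_response 11 7 ++ abs_colsq 16 11 ++
  mirror_step 14 6 2 (VSub (VAdd (VArr 10) (VArr 16)) (VArr 12)) ++
  abs_mul 13 14 ++ best_response 11 13 ++ add_to_average ++
  grad_rows 6 14 ++ grad_cols 6 11 ++ shift_grad ++
  abs_mul 13 8 ++ best_response 11 13 ++ abs_colsq 16 11 ++
  mirror_step 14 8 4 (entropy_shift 8) ++
  abs_mul 13 14 ++ best_response 11 13 ++ abs_colsq 16 11 ++
  mirror_step 16 8 4 (entropy_shift 14) ++ store_iterate.

Section Body.
Variables (R : realType) (n d : nat) (A : 'M[R]_(n, d)).
Implicit Types v : vstate R n d.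

Lemma denote_cat l1 l2 v v1 : denote_seq A l1 v = v1 ->
  denote_seq A (l1 ++ l2) v = denote_seq A l2 v1.
Proof. by rewrite /denote_seq foldl_cat => ->. Qed.

Lemma upd_upd (T : Type) (f : nat -> T) k x y : upd (upd f k x) k y = upd f k y.
Proof. by apply/funext => j; rewrite /upd; case: eqP. Qed.

Lemma upd_eq (T : Type) (f : nat -> T) k x : upd f k x k = x.
Proof. by rewrite /upd eqxx. Qed.

Lemma upd_neq (T : Type) (f : nat -> T) k x j : j != k -> upd f k x j = f j.
Proof. by rewrite /upd => /negbTE ->. Qed.

Variable L : R.
Hypothesis L_gt0 : 0 < L.

Lemma scale_mulmx p q (r : R) (B : 'M[R]_(p, q)) (y : 'cV[R]_q) :
  (r *: B) *m y = r *: (B *m y).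
Proof. by rewrite scalemxAl. Qed.

Lemma scale_trmx p q (r : R) (B : 'M[R]_(p, q)) : (r *: B)^T = r *: B^T.
Proof. by rewrite linearZ. Qed.

Lemma absmx_scale : absmx (L^-1 *: A) = L^-1 *: absmx A.
Proof. by apply/matrixP => i j; rewrite !mxE normrM gtr0_norm // invr_gt0. Qed.

Lemma grad_rowsE k src v : scalar v 3 = L^-1 ->
  denote_seq A (grad_rows k src) v =
  set_rowvec v 9 (k%:R^-1 *: ((L^-1 *: A) *m colvec v src + rowvec v 1)).
Proof.
move=> h; rewrite /denote_seq /= /set_rowvec /= upd_upd; congr (VState (upd _ _ _) _ _).
by apply/colP => i; rewrite mxE h upd_eq upd_neq // scale_mulmx !entryE div1r.
Qed.

Lemma grad_colsE k src v : scalar v 3 = L^-1 ->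
  denote_seq A (grad_cols k src) v =
  set_colvec v 10 (k%:R^-1 *: (colvec v 0 - (L^-1 *: A)^T *m rowvec v src)).
Proof.
move=> h; rewrite /denote_seq /= /set_colvec /= upd_upd; congr (VState _ (upd _ _ _) _).
by apply/colP => i; rewrite mxE h upd_eq upd_neq // scale_trmx scale_mulmx !entryE div1r.
Qed.

Lemma abs_mulE dst src v : scalar v 3 = L^-1 ->
  denote_seq A (abs_mul dst src) v =
  set_rowvec v dst (absmx (L^-1 *: A) *m colvec v src).
Proof.
move=> h; rewrite /denote_seq /= /set_rowvec /= upd_upd; congr (VState (upd _ _ _) _ _).
by apply/colP => i; rewrite mxE h upd_eq absmx_scale scale_mulmx !entryE.
Qed.

Lemma abs_colsqE dst src v : scalar v 3 = L^-1 ->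
  denote_seq A (abs_colsq dst src) v =
  set_colvec (set_rowvec v 15 (sqmx (rowvec v src))) dst
    ((absmx (L^-1 *: A))^T *m sqmx (rowvec v src)).
Proof.
move=> h; rewrite /denote_seq /= /set_colvec /set_rowvec /= upd_upd upd_eq.
have e : \col_i (rowvec v src i 0 * rowvec v src i 0) = sqmx (rowvec v src).
  by apply/colP => i; rewrite !mxE expr2.
rewrite e; congr (VState _ (upd _ _ _) _).
by apply/colP => i; rewrite mxE h upd_eq absmx_scale scale_trmx scale_mulmx !entryE.
Qed.

Lemma shift_gradE v :
  denote_seq A shift_grad v =
  set_rowvec v 9 (rowvec v 9 - 2 *: (diag_mx (rowvec v 5)^T *m rowvec v 7)).
Proof.
rewrite /denote_seq /= /set_rowvec; congr (VState (upd _ _ _) _ _).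
by apply/colP => i; rewrite mxE !entryE mul_diag_mx !mxE.
Qed.

Lemma clamp_tree (s : R) :
  (if s < -1 then -1 else if 1 < s then 1 else s) = Num.max (-1) (Num.min 1 s).
Proof.
rewrite minElt maxElt; case: (ltP 1 s) => h1; case: (ltP s (-1)) => h2.
- by exfalso; lra.
- by rewrite ifT //; lra.
- by rewrite ifF //; apply/negbTE; rewrite -leNgt; lra.
- by case: ltP => h3 //; lra.
Qed.

Lemma quot_treeE (S arr : nat -> R) p q :
  teval S arr (quot_tree p q) = truncate (oppe (equot (veval S arr p) (veval S arr q))).
Proof.
rewrite /quot_tree /=; move: (veval S arr p) (veval S arr q) => a b; rewrite !sub0r.
rewrite /equot; have [->|b0] := eqVneq b 0.
  rewrite ltxx oppr0; have [->|a0] := eqVneq a 0.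
    by rewrite ltxx invr0 mulr0 oppr0 oppe0 truncate_EFin minEle ifN ?ler10 // maxEle ifT //; lra.
  have [h|h] := ltP 0 a; first by rewrite /= truncate_ninfty.
  by rewrite lt_def eq_sym a0 h /= truncate_pinfty.
rewrite -EFinN truncate_EFin.
have [bn|bp] := ltP b 0.
  have e1 : (a < b) = (- (a / b) < -1).
    by rewrite ltrN2 ltr_ndivlMr // mul1r.
  have e2 : (- b < a) = (1 < - (a / b)).
    by rewrite ltrNr ltr_ndivrMr // mulN1r.
  by rewrite e1 e2; exact: clamp_tree.
have {}bp : 0 < b by rewrite lt_def b0.
have e1 : (b < a) = (- (a / b) < -1).
  by rewrite ltrN2 ltr_pdivlMr // mul1r.
have e2 : (a < - b) = (1 < - (a / b)).
  by rewrite [RHS]ltrNr ltr_pdivrMr // mulN1r.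
by rewrite e1 e2; exact: clamp_tree.
Qed.

Lemma best_responseE dst den v :
  denote_seq A (best_response dst den) v =
  set_rowvec v dst (projX_quot (rowvec v 9) (2 *: rowvec v den)).
Proof.
rewrite /denote_seq /= /set_rowvec; congr (VState (upd _ _ _) _ _).
apply/colP => i; rewrite mxE [RHS]mxE.
have := quot_treeE (scalar v) (fun a => rowvec v a i 0) (VArr 9)
  (VMul (VConst 2) (VArr den)).
by rewrite /quot_tree /= => ->; rewrite entryE.
Qed.

(** The unspecified vector and number are scratch values. *)
Lemma mirror_stepE dst src be w (W : 'cV[R]_d) v : dst != 18%N ->
  (forall j, veval (scalar v) (fun a => colvec v a j 0) w = W j 0) ->
  exists (g : 'cV[R]_d) (x : R), denote_seq A (mirror_step dst src be w) v =
  set_colvec (set_scalar (set_colvec v 18 g) 8 x) dst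
    (projY (hadamard (colvec v src) (expmx (- be%:R^-1 *: W)))).
Proof.
move=> d18 hW; set h := hadamard _ _.
exists (\col_j `|h j 0|), (l1norm h).
have e1 : \col_i (colvec v src i 0 * expR ((0 - 1 / be%:R) *
   veval (scalar v) (fun a => colvec v a i 0) w)) = h.
  by apply/colP => i; rewrite !mxE hW sub0r div1r.
rewrite /denote_seq /= e1.
have e2 : \col_i (if upd (colvec v) dst h dst i 0 < 0 then 0 - upd (colvec v) dst h dst i 0
     else upd (colvec v) dst h dst i 0) = \col_j `|h j 0|.
  apply/colP => i; rewrite [LHS]mxE [RHS]mxE upd_eq sub0r.
  by case: (ltP (h i 0) 0) => hi; [rewrite ltr0_norm | rewrite ger0_norm].
rewrite e2 /set_colvec /set_scalar /=.
have e3 : \sum_j upd (upd (colvec v) dst h) 18 (\col_j `|h j 0|) 18 j 0 = l1norm h.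
  by apply: eq_bigr => j _; rewrite upd_eq mxE.
rewrite e3; congr VState.
have ey : \col_i (1 / upd (scalar v) 8 (l1norm h) 8 *
    upd (upd (colvec v) dst h) 18 (\col_j `|h j 0|) dst i 0) = projY h.
  by apply/colP => i; rewrite [LHS]mxE upd_eq upd_neq // upd_eq [RHS]entryE div1r.
rewrite ey; apply/funext => a; rewrite /upd.
by case: (eqVneq a dst) => [//|ad]; case: eqP.
Qed.

End Body.

Section LoopBody.
Variables (R : realType) (n d : nat) (A : 'M[R]_(n, d)).
Variables (b : 'cV[R]_d) (c : 'cV[R]_n) (L : R) (T : nat).
Hypothesis L_gt0 : 0 < L.

Definition iterate_of (v : vstate R n d) : iterate R n d :=
  Iterate (rowvec v 5) (colvec v 6) (colvec v 8) (rowvec v 3) (colvec v 4).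

Definition ready (v : vstate R n d) : Prop :=
  [/\ scalar v 3 = L^-1, scalar v 6 = T%:R^-1,
      rowvec v 1 = L^-1 *: c & colvec v 0 = L^-1 *: b].

Lemma denote_add_to_average v : scalar v 6 = T%:R^-1 ->
  denote_seq A add_to_average v =
  set_colvec (set_rowvec v 3 (rowvec v 3 + T%:R^-1 *: rowvec v 11)) 4
    (colvec v 4 + T%:R^-1 *: colvec v 14).
Proof.
move=> h; rewrite /denote_seq /= /set_colvec /set_rowvec /= h.
congr (VState (upd _ _ _) (upd _ _ _) _);
  by apply/colP => i; rewrite [LHS]mxE !entryE.
Qed.

Lemma denote_store_iterate v :
  denote_seq A store_iterate v =
  set_colvec (set_colvec (set_rowvec v 5 (rowvec v 11)) 6 (colvec v 14)) 8 (colvec v 16).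
Proof.
rewrite /denote_seq /= /set_colvec /set_rowvec /=.
congr (VState (upd _ _ _) (upd (upd _ _ _) _ _) _);
  by apply/colP => i; rewrite mxE.
Qed.

Lemma mirror14_gradient v :
  exists g r,
    denote_seq A (mirror_step 14 6 2 (VSub (VAdd (VArr 10) (VArr 16)) (VArr 12))) v =
    set_colvec (set_scalar (set_colvec v 18 g) 8 r) 14
      (projY (hadamard (colvec v 6) (expmx (- 2^-1 *:
         (colvec v 10 + colvec v 16 - colvec v 12))))).
Proof. by apply: mirror_stepE => // j; rewrite !entryE. Qed.

Lemma mirror_entropy dst y v : dst != 18%N ->
  exists g r,
    denote_seq A (mirror_step dst 8 4 (entropy_shift y)) v =
    set_colvec (set_scalar (set_colvec v 18 g) 8 r) dst
      (projY (hadamard (colvec v 8) (expmx (- 4^-1 *: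
         (colvec v 10 + colvec v 16 + 4 *: lnmx (colvec v y) - colvec v 12
          - 4 *: lnmx (colvec v 6)))))).
Proof. by move=> d18; apply: mirror_stepE => // j; rewrite !entryE. Qed.

(** Symbolic execution: each block of instructions leads from one named state to
the next, and the vectors met on the way are those of bs_step. *)
Lemma denote_loop_body v : ready v ->
  let v' := denote_seq A loop_body v in
  [/\ ready v', iterate_of v' =
        bs_step (L^-1 *: A) (L^-1 *: b) (L^-1 *: c) T (iterate_of v) &
      forall r, r != 8%N -> scalar v' r = scalar v r].
Proof.
case: v => N D S [h3 h6 hc hb]; rewrite /= in h3 h6 hc hb.
pose x := N 5%N; pose y := D 6%N; pose yb := D 8%N.
pose A' := L^-1 *: A.
pose gx := 3^-1 *: (A' *m y + N 1%N).
pose gy := 3^-1 *: (D 0%N - A'^T *m x).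
pose v1 := set_rowvec (VState N D S) 9 gx.
have e1 : denote_seq A (grad_rows 3 6) (VState N D S) = v1 by apply: grad_rowsE.
pose v2 := set_colvec v1 10 gy.
have e2 : denote_seq A (grad_cols 3 5) v1 = v2 by apply: grad_colsE.
pose s := absmx A' *m y.
pose v3 := set_rowvec v2 7 s.
have e3 : denote_seq A (abs_mul 7 6) v2 = v3 by apply: abs_mulE.
pose qx := (absmx A')^T *m sqmx x.
pose v4 := set_colvec (set_rowvec v3 15 (sqmx x)) 12 qx.
have e4 : denote_seq A (abs_colsq 12 5) v3 = v4 by apply: abs_colsqE.
pose num := gx - 2 *: (diag_mx x^T *m s).
pose v5 := set_rowvec v4 9 num.
have e5 : denote_seq A shift_grad v4 = v5 by apply: shift_gradE.
pose xs := projX_quot num (2 *: s).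
pose v6 := set_rowvec v5 11 xs.
have e6 : denote_seq A (best_response 11 7) v5 = v6 by apply: best_responseE.
pose v7 := set_colvec (set_rowvec v6 15 (sqmx xs)) 16 ((absmx A')^T *m sqmx xs).
have e7 : denote_seq A (abs_colsq 16 11) v6 = v7 by apply: abs_colsqE.
pose y' := projY (hadamard y (expmx (- 2^-1 *: (gy + (absmx A')^T *m sqmx xs - qx)))).
have [g8 [s8 e8]] : exists g r,
    denote_seq A (mirror_step 14 6 2 (VSub (VAdd (VArr 10) (VArr 16)) (VArr 12))) v7 =
    set_colvec (set_scalar (set_colvec v7 18 g) 8 r) 14 y'.
  exact: mirror14_gradient v7.
set v8 := set_colvec _ 14 _ in e8.
pose v9 := set_rowvec v8 13 (absmx A' *m y').
have e9 : denote_seq A (abs_mul 13 14) v8 = v9 by apply: abs_mulE.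
pose x' := projX_quot num (2 *: (absmx A' *m y')).
pose v10 := set_rowvec v9 11 x'.
have e10 : denote_seq A (best_response 11 13) v9 = v10 by apply: best_responseE.
pose v11 := set_colvec (set_rowvec v10 3 (N 3%N + T%:R^-1 *: x')) 4 (D 4%N + T%:R^-1 *: y').
have e11 : denote_seq A add_to_average v10 = v11 by apply: denote_add_to_average.
pose hx := 6^-1 *: (A' *m y' + N 1%N).
pose hy := 6^-1 *: (D 0%N - A'^T *m x').
pose v12 := set_rowvec v11 9 hx.
have e12 : denote_seq A (grad_rows 6 14) v11 = v12 by apply: grad_rowsE.
pose v13 := set_colvec v12 10 hy.
have e13 : denote_seq A (grad_cols 6 11) v12 = v13 by apply: grad_colsE.
pose num' := hx - 2 *: (diag_mx x^T *m s).
pose v14 := set_rowvec v13 9 num'.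
have e14 : denote_seq A shift_grad v13 = v14 by apply: shift_gradE.
pose v15 := set_rowvec v14 13 (absmx A' *m yb).
have e15 : denote_seq A (abs_mul 13 8) v14 = v15 by apply: abs_mulE.
pose xb := projX_quot num' (2 *: (absmx A' *m yb)).
pose v16 := set_rowvec v15 11 xb.
have e16 : denote_seq A (best_response 11 13) v15 = v16 by apply: best_responseE.
pose v17 := set_colvec (set_rowvec v16 15 (sqmx xb)) 16 ((absmx A')^T *m sqmx xb).
have e17 : denote_seq A (abs_colsq 16 11) v16 = v17 by apply: abs_colsqE.
pose y1 := projY (hadamard yb (expmx (- 4^-1 *: (hy + (absmx A')^T *m sqmx xb
  + 4 *: lnmx yb - qx - 4 *: lnmx y)))).
have [g18 [s18 e18]] : exists g r,
    denote_seq A (mirror_step 14 8 4 (entropy_shift 8)) v17 =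
    set_colvec (set_scalar (set_colvec v17 18 g) 8 r) 14 y1.
  exact: (mirror_entropy 8 v17 (dst := 14)).
set v18 := set_colvec _ 14 _ in e18.
pose v19 := set_rowvec v18 13 (absmx A' *m y1).
have e19 : denote_seq A (abs_mul 13 14) v18 = v19 by apply: abs_mulE.
pose x1 := projX_quot num' (2 *: (absmx A' *m y1)).
pose v20 := set_rowvec v19 11 x1.
have e20 : denote_seq A (best_response 11 13) v19 = v20 by apply: best_responseE.
pose v21 := set_colvec (set_rowvec v20 15 (sqmx x1)) 16 ((absmx A')^T *m sqmx x1).
have e21 : denote_seq A (abs_colsq 16 11) v20 = v21 by apply: abs_colsqE.
pose yb1 := projY (hadamard yb (expmx (- 4^-1 *: (hy + (absmx A')^T *m sqmx x1
  + 4 *: lnmx y1 - qx - 4 *: lnmx y)))).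
have [g22 [s22 e22]] : exists g r,
    denote_seq A (mirror_step 16 8 4 (entropy_shift 14)) v21 =
    set_colvec (set_scalar (set_colvec v21 18 g) 8 r) 16 yb1.
  exact: (mirror_entropy 14 v21 (dst := 16)).
set v22 := set_colvec _ 16 _ in e22.
have e23 := denote_store_iterate v22.
rewrite /loop_body.
rewrite (denote_cat _ e1) (denote_cat _ e2) (denote_cat _ e3) (denote_cat _ e4)
  (denote_cat _ e5) (denote_cat _ e6) (denote_cat _ e7) (denote_cat _ e8)
  (denote_cat _ e9) (denote_cat _ e10) (denote_cat _ e11) (denote_cat _ e12)
  (denote_cat _ e13) (denote_cat _ e14) (denote_cat _ e15) (denote_cat _ e16)
  (denote_cat _ e17) (denote_cat _ e18) (denote_cat _ e19) (denote_cat _ e20)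
  (denote_cat _ e21) (denote_cat _ e22) e23.
split; first by split.
- rewrite /bs_step /iterate_of.
  change (Iterate x1 y1 yb1 (N 3%N + T%:R^-1 *: x') (D 4%N + T%:R^-1 *: y') =
    bs_step A' (L^-1 *: b) (L^-1 *: c) T (Iterate x y yb (N 3%N) (D 4%N))).
  by rewrite -hb -hc.
- move=> r r8; change (upd (upd (upd S 8 s8) 8 s18) 8 s22 r = S r).
  by rewrite (upd_neq _ _ r8) (upd_neq _ _ r8) (upd_neq _ _ r8).
Qed.
End LoopBody.

(** Summing ones gives d as a real number, and the largest entry of |A|^T 1 is the
norm of A. *)
Definition setup : seq instr :=
  [:: DMap 16 (VLeaf (VConst 1)); DSum 1 16;
      NMap 15 (VLeaf (VConst 1)); MulD true 16 15; DMax 2 16;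
      Assign 3 (VDiv (VConst 1) (VReg 2));
      Assign 4 (VDiv (VMul (VMul (VConst 6)
        (VAdd (VMul (VConst 8) (VLn (VReg 1))) (VConst 1))) (VReg 2)) (VReg 0));
      Assign 5 (VConst 0)].

Definition count_up (r : nat) : instr := Assign r (VAdd (VReg r) (VConst 1)).

Definition start : seq instr :=
  [:: Assign 6 (VDiv (VConst 1) (VReg 5)); Assign 7 (VConst 0);
      DMap 0 (VLeaf (scaled (VArr 0))); NMap 1 (VLeaf (scaled (VArr 1)));
      NMap 5 (VLeaf (VConst 0));
      DMap 6 (VLeaf (VDiv (VConst 1) (VReg 1)));
      DMap 8 (VLeaf (VDiv (VConst 1) (VReg 1)));
      NMap 3 (VLeaf (VConst 0)); DMap 4 (VLeaf (VConst 0))].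

Definition iteration : seq instr := loop_body ++ [:: count_up 7].

(** The machine does not round, so T is found by counting up in a real register
until the real bound is reached. *)
Definition box_simplex_program (O : Type) (mvc : mv_name -> nat -> nat -> cmd O) : cmd O :=
  Seq (compile_seq mvc setup)
    (Seq (While (RLt (RReg 5) (RReg 4)) (compile_seq mvc [:: count_up 5]))
      (Seq (compile_seq mvc start)
        (While (RLt (RReg 7) (RReg 5)) (compile_seq mvc iteration)))).

Definition program_cost (Kmv : nat) : nat :=
  seq_cost Kmv setup + (seq_cost Kmv [:: count_up 5] + 8)
  + seq_cost Kmv start + (seq_cost Kmv iteration + 8).

Section Program.
Variables (R : realType) (n d : nat) (A : 'M[R]_(n, d.+1)).
Variables (b : 'cV[R]_d.+1) (c : 'cV[R]_n) (eps : R).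
Hypothesis eps_range : 0 < eps < opnorm11 A.
Implicit Types v : vstate R n d.+1.

Let L := opnorm11 A.
Let T := bs_T A eps.
Let X := 6 * (8 * ln d.+1%:R + 1) * L / eps.

Let L_gt0 : 0 < L.
Proof. by move: eps_range => /andP[]; exact: lt_trans. Qed.

Definition holds_data v := [/\ scalar v 1 = d.+1%:R, scalar v 3 = L^-1,
  scalar v 4 = X, rowvec v 1 = c & colvec v 0 = b].

Lemma bigmax_colsum :
  \big[Num.max/0]_j ((absmx A)^T *m (const_mx 1 : 'cV[R]_n)) j 0 = L.
Proof.
have e j : ((absmx A)^T *m (const_mx 1 : 'cV[R]_n)) j 0 = \sum_i `|A i j|.
  by rewrite mxE; apply: eq_bigr => i _; rewrite !mxE mulr1.
apply/eqP; rewrite eq_le; apply/andP; split.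
  by apply: bigmax_le => [|j _]; [exact: ltW | rewrite e; exact: colsum_le_opnorm].
apply: opnorm_le_colsum => // j; rewrite -e.
exact: (le_bigmax _ (fun j => ((absmx A)^T *m (const_mx 1 : 'cV[R]_n)) j 0) j).
Qed.

Lemma denote_setup v : scalar v 0 = eps -> rowvec v 1 = c -> colvec v 0 = b ->
  let v' := denote_seq A setup v in holds_data v' /\ scalar v' 5 = 0.
Proof.
move=> he hc hb.
have ones : \sum_j (\col_(j < d.+1) (1 : R)) j 0 = d.+1%:R.
  under eq_bigr => j _ do rewrite mxE.
  by rewrite sumr_const card_ord.
have e1 : \col_(i < n) (1 : R) = const_mx 1 by apply/colP => i; rewrite !mxE.
rewrite /denote_seq /= /holds_data /=.
rewrite !upd_eq e1 ones bigmax_colsum.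
by split; [split | ]; rewrite /upd /= ?he ?div1r.
Qed.

Lemma denote_count k v : holds_data v -> scalar v 5 = 0 ->
  let v' := iter k (denote_seq A [:: count_up 5]) v in
  holds_data v' /\ scalar v' 5 = k%:R.
Proof.
move=> hv h5; elim: k => [//|k [[h1 h3 h4 hc hb] h]].
by rewrite iterS; split; [split | rewrite /= /upd /= h natr1].
Qed.

Lemma denote_start v : holds_data v -> scalar v 5 = T%:R ->
  let v' := denote_seq A start v in
  [/\ ready b c L T v', iterate_of v' = bs_init R n d.+1,
      scalar v' 7 = 0 & scalar v' 5 = T%:R].
Proof.
move=> [h1 h3 h4 hc hb] h5.
rewrite /denote_seq /=; split=> //.
- split; rewrite /= /upd /= ?h3 ?h5 ?div1r //.
    by apply/colP => i; rewrite mxE entryE hc.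
  by apply/colP => i; rewrite mxE entryE hb.
- rewrite /iterate_of /bs_init /= /upd /= h1.
  by congr Iterate; apply/colP => i; rewrite !mxE ?div1r.
Qed.

Lemma denote_iteration k v : ready b c L T v -> iterate_of v = bs_init R n d.+1 ->
  scalar v 7 = 0 -> scalar v 5 = T%:R ->
  let v' := iter k (denote_seq A iteration) v in
  [/\ ready b c L T v',
      iterate_of v' = iter k (bs_step (L^-1 *: A) (L^-1 *: b) (L^-1 *: c) T)
                        (bs_init R n d.+1),
      scalar v' 7 = k%:R & scalar v' 5 = T%:R].
Proof.
move=> hr hz h7 h5; elim: k => [//|k]; rewrite 2!iterS.
set v1 := iter k _ v; set z1 := iter k _ _ => -[r1 i1 k1 t1].
have [r2 i2 s2] := denote_loop_body A L_gt0 r1.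
rewrite /iteration (denote_cat _ erefl).
move: (denote_seq A loop_body v1) r2 i2 s2 => v2 r2 i2 s2.
have -> : denote_seq A [:: count_up 7] v2 = set_scalar v2 7 (scalar v2 7 + 1) by [].
have [ra rb rc rd] := r2.
split.
- by split; [exact: ra | exact: rb | exact: rc | exact: rd].
- by rewrite -i1 -i2.
- by rewrite /= upd_eq s2 // k1 natr1.
- by rewrite /= upd_neq // s2 // t1.
Qed.

Variables (s0 : state R) (O : Type) (sub : O -> mv_subroutine R).
Variables (mvc : mv_name -> nat -> nat -> cmd O) (Kmv M : nat).
Hypothesis mulN_ok : forall abs dst src, is_rowvec dst -> is_colvec src ->
  multiplies n d.+1 s0 sub Kmv M (mulN_mx A abs) (mvc (mulN_name abs) src dst) src dst.
Hypothesis mulD_ok : forall abs dst src, is_colvec dst -> is_rowvec src ->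
  multiplies n d.+1 s0 sub Kmv M (mulD_mx A abs) (mvc (mulD_name abs) src dst) src dst.
Hypotheses (nM : (n <= M)%N) (dM : (d.+1 <= M)%N).

Lemma box_simplex_program_correct : holds_params s0 b c eps ->
  exists t s', [/\ exec sub (box_simplex_program mvc) s0 t s',
    holds_output s' (box_simplex A b c eps) &
    (t <= program_cost Kmv * (T * M))%N].
Proof.
move=> [p1 p2 p3 p4 p5].
have M1 : (0 < M)%N by exact: leq_trans dM.
have [T0 TX XT] := bs_T_bounds eps_range; rewrite -/T -/X in T0 TX XT.
pose v0 : vstate R n d.+1 := VState (fun a => \col_i rarr s0 a i)
  (fun a => \col_i rarr s0 a i) (rreg s0).
have r0 : represents s0 s0 v0.
  by split=> // a _ i; rewrite /= mxE.
have hc0 : rowvec v0 1 = c by apply/colP => i; rewrite mxE p5.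
have hb0 : colvec v0 0 = b by apply/colP => i; rewrite mxE p4.
have [t1 [s1 [x1 l1 r1]]] := simulation_seq mulN_ok mulD_ok nM dM M1 (l := setup) isT r0.
have [d1 z1] := denote_setup (v := v0) p3 hc0 hb0.
have lt1 k : (k < T)%N -> scalar (iter k (denote_seq A [:: count_up 5]) (denote_seq A setup v0)) 5 <
   scalar (iter k (denote_seq A [:: count_up 5]) (denote_seq A setup v0)) 4.
  move=> kT; have [[_ _ -> _ _] ->] := denote_count k d1 z1.
  rewrite -(ltrD2r 1) natr1; apply: le_lt_trans XT.
  by rewrite ler_nat.
have ge1 : ~~ (scalar (iter T (denote_seq A [:: count_up 5]) (denote_seq A setup v0)) 5 <
   scalar (iter T (denote_seq A [:: count_up 5]) (denote_seq A setup v0)) 4).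
  by have [[_ _ -> _ _] ->] := denote_count T d1 z1; rewrite -leNgt.
have [t2 [s2 [x2 l2 r2]]] := simulation_while mulN_ok mulD_ok nM dM M1 (l := [:: count_up 5])
  isT r1 lt1 ge1.
have [d2 z2] := denote_count T d1 z1.
set v2 := iter T _ _ in r2 d2 z2.
have [t3 [s3 [x3 l3 r3]]] := simulation_seq mulN_ok mulD_ok nM dM M1 (l := start) isT r2.
have [d3 i3 k3 z3] := denote_start d2 z2.
set v3 := denote_seq A start v2 in r3 d3 i3 k3 z3.
have lt3 k : (k < T)%N -> scalar (iter k (denote_seq A iteration) v3) 7 <
   scalar (iter k (denote_seq A iteration) v3) 5.
  by move=> kT; have [_ _ -> ->] := denote_iteration k d3 i3 k3 z3; rewrite ltr_nat.
have ge3 : ~~ (scalar (iter T (denote_seq A iteration) v3) 7 <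
   scalar (iter T (denote_seq A iteration) v3) 5).
  by have [_ _ -> ->] := denote_iteration T d3 i3 k3 z3; rewrite ltxx.
have [t4 [s4 [x4 l4 r4]]] := simulation_while mulN_ok mulD_ok nM dM M1 (l := iteration)
  isT r3 lt3 ge3.
have [_ i4 _ _] := denote_iteration T d3 i3 k3 z3.
exists (t1 + (t2 + (t3 + t4)))%N, s4; split.
- exact: ExecSeq x1 (ExecSeq x2 (ExecSeq x3 x4)).
- have [_ _ rv cv] := r4.
  split; rewrite /box_simplex -/L -/T -i4 /=; [exact: rv | exact: cv].
- rewrite /program_cost.
  move: (seq_cost Kmv setup) (seq_cost Kmv [:: count_up 5]) (seq_cost Kmv start)
    (seq_cost Kmv iteration) l1 l2 l3 l4 => k1 k2 k3' k4 l1 l2 l3 l4.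
  nia.
Qed.

(** From ln d >= 1 / 2 and L / eps >= 1, the two lower-order terms 6 L / eps and 1
are at most 12 and 2 times L ln d / eps, and 62 = 48 + 12 + 2. *)
Lemma bs_T_le : (1 < d.+1)%N -> T%:R <= 62 * (L * ln d.+1%:R / eps).
Proof.
move=> d1; have [_ _ XT] := bs_T_bounds eps_range; rewrite -/T -/X in XT.
apply: le_trans (ltW XT) _.
have /andP[e0 eL] := eps_range; rewrite -/L in eL.
have l2 : 1 <= 2 * ln (d.+1%:R : R).
  have h : 0 < (2^-1 : R) <= 1 by lra.
  have := neg_ln_ge h; rewrite lnV ?posrE // opprK.
  have : ln (2 : R) <= ln (d.+1%:R : R) by rewrite ler_ln ?posrE ?ltr0n // ler_nat.
  lra.
have q1 : 1 <= L / eps by rewrite ler_pdivlMr // mul1r ltW.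
have -> : X = 48 * (L * ln d.+1%:R / eps) + 6 * (L / eps) by rewrite /X; ring.
have h1 : 0 <= (L / eps) * (2 * ln d.+1%:R - 1) by apply: mulr_ge0; lra.
have e : L * ln d.+1%:R / eps = (L / eps) * ln d.+1%:R by ring.
rewrite e; lra.
Qed.

Lemma time_bound (K t : nat) : (1 < d.+1)%N -> (t <= K * (T * M))%N ->
  t%:R <= (62 * K)%:R * (M%:R * (L * ln d.+1%:R / eps)).
Proof.
move=> d1 ht; have : t%:R <= (K * (T * M))%:R :> R by rewrite ler_nat.
move=> h; apply: le_trans h _; rewrite !natrM.
have := ler_wpM2l (_ : 0 <= K%:R * M%:R) (bs_T_le d1).
rewrite mulr_ge0 // => /(_ isT); lra.
Qed.
End Program.

(** * Matrix-vector products *)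

Section Products.
Variables (R : realType) (n d : nat) (A : 'M[R]_(n, d)) (s0 : state R) (M : nat).
Hypothesis M1 : (0 < M)%N.

Section Subroutines.
Variable Tmv : mv_name -> nat.
Hypothesis TmvM : forall o, (Tmv o <= M)%N.
Let sub := game_subroutines A Tmv.

Lemma call_multiplies p q (B : 'M[R]_(p, q)) o src dst (t : nat) :
  dst != 2%N -> (t <= M)%N -> sub o = MvSubroutine B t ->
  multiplies n d s0 sub 2 M B (MatVec o src dst) src dst.
Proof.
move=> d2 tM e s [f1 f2 f3 f4 f5].
have x := ExecMatVec sub o src dst s; rewrite e /= in x.
exists t.+1, (run_matvec (MvSubroutine B t) src dst s); split=> //; first by lia.
  split=> //= i; rewrite upd_neq // eq_sym; exact: d2.
split=> [a ad i|v hv i] /=; first by rewrite upd_neq.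
rewrite upd_eq; case: insubP => [i' _ ei|]; last by rewrite ltn_ord.
rewrite (val_inj ei); congr ((_ *m _) _ _).
by apply/colP => j; rewrite mxE hv.
Qed.

Lemma subroutines_mulN abs dst src : is_rowvec dst -> is_colvec src ->
  multiplies n d s0 sub 2 M (mulN_mx A abs) (MatVec (mulN_name abs) src dst) src dst.
Proof.
move=> hd hs; have d2 : dst != 2%N by rewrite eq_sym rowvec_neq2.
case: abs.
  exact: (@call_multiplies _ _ (absmx A) MvAbs src dst _ d2 (TmvM _) erefl).
exact: (@call_multiplies _ _ A MvA src dst _ d2 (TmvM _) erefl).
Qed.

Lemma subroutines_mulD abs dst src : is_colvec dst -> is_rowvec src ->
  multiplies n d s0 sub 2 M (mulD_mx A abs) (MatVec (mulD_name abs) src dst) src dst.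
Proof.
move=> hd hs; have d2 : dst != 2%N by rewrite eq_sym colvec_neq2.
case: abs; last exact: (@call_multiplies _ _ A^T MvAT src dst _ d2 (TmvM _) erefl).
by rewrite /= /absmx map_trmx; exact: (@call_multiplies _ _ (absmx A^T) MvAbsT src dst _ d2 (TmvM _) erefl).
Qed.
End Subroutines.
End Products.

Definition row_index : iexp := IGet 0 (IReg 3).
Definition col_index : iexp := IGet 1 (IReg 3).

Definition add_entry (abs : bool) (tgt pos : iexp) (src dst : nat) : cmd void :=
  let term := RMul (at_index 2) (RGet src pos) in
  let plus := RPut void dst tgt (RAdd (RGet dst tgt) term) in
  let minus := RPut void dst tgt (RSub (RGet dst tgt) term) in
  if abs then If (RLt (at_index 2) (RConst 0)) minus plus else plus.

Definition entries_product (o : mv_name) (src dst : nat) : cmd void :=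
  let: (len, abs, tgt, pos) :=
    match o with
    | MvA => (0%N, false, row_index, col_index)
    | MvAbs => (0%N, true, row_index, col_index)
    | MvAT => (1%N, false, col_index, row_index)
    | MvAbsT => (1%N, true, col_index, row_index)
    end in
  Seq (map_loop void len dst (VLeaf (VConst 0)))
      (for_loop 2 (add_entry abs tgt pos src dst)).

Section Entries.
Variables (R : realType) (n d : nat) (A : 'M[R]_(n, d)) (s0 : state R) (M : nat).
Hypothesis M1 : (0 < M)%N.
Variable es : seq ('I_n * 'I_d).
Hypotheses (es_uniq : uniq es) (esP : forall ij, (ij \in es) = (A ij.1 ij.2 != 0)).
Hypotheses (es_size : ireg s0 2 = size es) (esM : (size es <= M)%N).
Hypothesis es_val : forall k : 'I_(size es),
  let ij := tnth (in_tuple es) k in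
  [/\ iarr s0 0 k = ij.1, iarr s0 1 k = ij.2 & rarr s0 2 k = A ij.1 ij.2].
Let sub := @no_subroutine R.

Definition entry_value (abs : bool) (ij : 'I_n * 'I_d) : R :=
  if abs then `|A ij.1 ij.2| else A ij.1 ij.2.

(** The entries missing from the list are zero. *)
Lemma sum_entries (abs : bool) (P : pred ('I_n * 'I_d)) (w : 'I_n * 'I_d -> R) :
  \sum_(e <- es | P e) entry_value abs e * w e = \sum_(e | P e) entry_value abs e * w e.
Proof.
rewrite -big_filter big_uniq ?filter_uniq //= [RHS]big_mkcond [LHS]big_mkcond /=.
apply: eq_bigr => e _; rewrite mem_filter esP; case: (P e) => //=.
by case: eqP => //= e0; rewrite /entry_value e0 normr0 if_same mul0r.
Qed.

Lemma rows_product abs (v : 'cV[R]_d) i :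
  \sum_(e <- es | e.1 == i) entry_value abs e * v e.2 0 = (mulN_mx A abs *m v) i 0.
Proof.
rewrite sum_entries mxE.
transitivity (\sum_(k | k == i) \sum_j entry_value abs (k, j) * v j 0).
  rewrite pair_big /=; apply: eq_big => [e|e _]; first by rewrite andbT.
  by case: e.
rewrite big_pred1_eq; apply: eq_bigr => j _; rewrite /entry_value /mulN_mx.
by case: abs; rewrite ?mxE.
Qed.

Lemma cols_product abs (v : 'cV[R]_n) j :
  \sum_(e <- es | e.2 == j) entry_value abs e * v e.1 0 = (mulD_mx A abs *m v) j 0.
Proof.
rewrite sum_entries mxE.
transitivity (\sum_i \sum_(k | k == j) entry_value abs (i, k) * v i 0).
  by rewrite pair_big /=; apply: eq_big => [e|[e1 e2] _].
apply: eq_bigr => i _; rewrite big_pred1_eq /entry_value /mulD_mx.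
by case: abs; rewrite ?mxE.
Qed.

Lemma exec_add_entry abs tgt pos src dst (s : state R) (ij : 'I_n * 'I_d) :
  icost tgt = 2%N -> icost pos = 2%N ->
  rarr s 2 (ireg s 3) = A ij.1 ij.2 ->
  exists2 t, (t <= 18)%N &
    exec sub (add_entry abs tgt pos src dst) s t
     (set_rarr s dst (ieval s tgt) (rarr s dst (ieval s tgt)
        + entry_value abs ij * rarr s src (ieval s pos))).
Proof.
move=> c1 c2 e; rewrite /add_entry /entry_value.
pose term := RMul (at_index 2) (RGet src pos).
have plus : exec sub (RPut void dst tgt (RAdd (RGet dst tgt) term)) s 13
     (set_rarr s dst (ieval s tgt) (rarr s dst (ieval s tgt)
        + A ij.1 ij.2 * rarr s src (ieval s pos))).
  have := ExecRPut sub dst tgt (RAdd (RGet dst tgt) term) s.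
  by rewrite /= c1 c2 e.
have minus : exec sub (RPut void dst tgt (RSub (RGet dst tgt) term)) s 13
     (set_rarr s dst (ieval s tgt) (rarr s dst (ieval s tgt)
        - A ij.1 ij.2 * rarr s src (ieval s pos))).
  have := ExecRPut sub dst tgt (RSub (RGet dst tgt) term) s.
  by rewrite /= c1 c2 e.
case: abs; last by exists 13%N.
exists (5 + 13)%N => //.
have [neg|pos0] := ltP (A ij.1 ij.2) 0.
  apply: (@ExecIfTrue _ _ sub (RLt (at_index 2) (RConst 0))); first by rewrite /= e.
  by rewrite ltr0_norm // mulNr; exact: minus.
apply: (@ExecIfFalse _ _ sub (RLt (at_index 2) (RConst 0))); first by rewrite /= e -leNgt.
by rewrite ger0_norm //; exact: plus.
Qed.

(** After k entries, the target holds the partial sums over the first k entries of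
the list. Clearing the target costs at most 11 M + 6 and the pass over the entries
at most 26 M + 6, whence 49. *)
Lemma entries_multiplies p q (B : 'M[R]_(p, q)) abs len tgt pos src dst
    (tg : 'I_n * 'I_d -> 'I_p) (ps : 'I_n * 'I_d -> 'I_q) :
  icost tgt = 2%N -> icost pos = 2%N -> (p <= M)%N ->
  len != 3%N -> (forall s, frame n d s0 s -> ireg s len = p) ->
  (forall (s : state R) (k : 'I_(size es)), iarr s = iarr s0 -> ireg s 3 = k ->
    ieval s tgt = tg (tnth (in_tuple es) k) /\ ieval s pos = ps (tnth (in_tuple es) k)) ->
  dst != 2%N -> src != dst ->
  (forall (v : 'cV[R]_q) i, \sum_(e <- es | tg e == i) entry_value abs e * v (ps e) 0 = (B *m v) i 0) ->
  multiplies n d s0 sub 49 M B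
    (Seq (map_loop void len dst (VLeaf (VConst 0)))
         (for_loop 2 (add_entry abs tgt pos src dst))) src dst.
Proof.
move=> c1 c2 pM len3 hlen hidx d2 sd hB s fr; have [f1 f2 f3 f4 f5] := fr.
have [t1 [s1 [x1 l1 h1 h2 [h3 h4]]]] :=
  exec_map_loop sub dst (VLeaf (VConst 0)) (hlen s fr) len3.
have fr1 : frame n d s0 s1.
  split; rewrite ?h1 ?h2 // => i; rewrite h4 eq_sym (negbTE d2) /=; exact: f5.
pose I k (s' : state R) := [/\ frame n d s0 s', rreg s' = rreg s,
  (forall a, a != dst -> forall i, rarr s' a i = rarr s a i) &
  forall i : 'I_p, rarr s' dst i =
    \sum_(e <- take k es | tg e == i) entry_value abs e * rarr s src (ps e)].
have sz : ireg s1 2 = size es by have [_ _ -> _ _] := fr1.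
have [||t2 [s2 [x2 l2 [fr2 r2 o2 w2]]]] :=
  @exec_for_loop _ _ sub 2 (add_entry abs tgt pos src dst) I 18 (size es) s1 sz isT.
- split=> //= [a ad i|i]; first by rewrite h4 (negbTE ad).
  by rewrite take0 big_nil h4 eqxx ltn_ord.
- move=> k s3 km sz3 e3 [fr3 r3 o3 w3]; have [g1 g2 g3 g4 g5] := fr3.
  have [] := es_val (Ordinal km); set ij := tnth _ _ => /= v1 v2 v3.
  have [et ep] := hidx s3 (Ordinal km) g4 e3; rewrite -/ij in et ep.
  have val3 : rarr s3 2 (ireg s3 3) = A ij.1 ij.2 by rewrite e3 g5.
  have [t lt x] := exec_add_entry abs src dst c1 c2 val3.
  rewrite et ep in x.
  eexists t, _; split; [exact: x | exact: lt | exact: sz3 | exact: e3 | ].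
  split=> //=.
  + split=> //= i; rewrite upd_neq; [exact: g5 | by rewrite eq_sym].
  + by move=> a ad i; rewrite upd_neq //; exact: o3.
  + move=> i; rewrite upd_eq (take_nth ij) // -cats1 big_cat big_cons big_nil /=.
    have -> : nth ij es k = ij by rewrite [RHS](tnth_nth ij).
    rewrite addr0 /upd (o3 src sd).
    case: (eqVneq (tg ij) i) => [<-|ne]; first by rewrite eqxx w3.
    rewrite addr0 ifN ?w3 //; apply: contra ne => /eqP e; apply/eqP; exact: val_inj.
exists (t1 + t2)%N, s2; split.
- exact: ExecSeq x1 x2.
- by move: l1 l2; rewrite /=; nia.
- exact: fr2.
- exact: r2.
- split=> [//|v hv i]; rewrite w2 take_size -hB.
  by apply: eq_bigr => e _; rewrite hv.
Qed.

Lemma entries_mulN abs dst src : (n <= M)%N -> is_rowvec dst -> is_colvec src ->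
  multiplies n d s0 sub 49 M (mulN_mx A abs) (entries_product (mulN_name abs) src dst) src dst.
Proof.
move=> hM hd hs.
have d2 : dst != 2%N by rewrite eq_sym rowvec_neq2.
have sd : src != dst by apply/eqP => e; rewrite e rowvec_not_colvec in hs.
suff h : multiplies n d s0 sub 49 M (mulN_mx A abs)
    (Seq (map_loop void 0 dst (VLeaf (VConst 0)))
         (for_loop 2 (add_entry abs row_index col_index src dst))) src dst.
  by move: h; case: abs.
apply: (entries_multiplies (tg := fst) (ps := snd)) => //.
- by move=> s [].
- by move=> s k e1 e3; rewrite /= e1 e3; have [-> ->] := es_val k.
- by move=> v i; exact: rows_product.
Qed.

Lemma entries_mulD abs dst src : (d <= M)%N -> is_colvec dst -> is_rowvec src ->
  multiplies n d s0 sub 49 M (mulD_mx A abs) (entries_product (mulD_name abs) src dst) src dst.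
Proof.
move=> hM hd hs.
have d2 : dst != 2%N by rewrite eq_sym colvec_neq2.
have sd : src != dst by apply/eqP => e; rewrite e colvec_not_rowvec in hs.
suff h : multiplies n d s0 sub 49 M (mulD_mx A abs)
    (Seq (map_loop void 1 dst (VLeaf (VConst 0)))
         (for_loop 2 (add_entry abs col_index row_index src dst))) src dst.
  by move: h; case: abs.
apply: (entries_multiplies (tg := snd) (ps := fst)) => //.
- by move=> s [].
- by move=> s k e1 e3; rewrite /= e1 e3; have [-> ->] := es_val k.
- by move=> v i; exact: cols_product.
Qed.
End Entries.


(** * Saddle point and running time *)

Theorem theorem1 :
  (* correctness *)
  (forall (R : realType) (n d : nat) (A : 'M[R]_(n, d)) (b : 'cV[R]_d)
      (c : 'cV[R]_n) (eps : R),
      (1 < d)%N -> 0 < eps < opnorm11 A ->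
      let xy := box_simplex A b c eps in approx_saddle A b c eps xy.1 xy.2)
  /\
  (* running time, with direct access to the nonzero entries of A *)
  (exists (P : cmd void) (C : nat),
    forall (R : realType) (n d : nat) (A : 'M[R]_(n, d)) (b : 'cV[R]_d)
      (c : 'cV[R]_n) (eps : R) (s : state R),
      (1 < d)%N -> 0 < eps < opnorm11 A ->
      (maxn n d <= nnz A)%N ->
      holds_params s b c eps -> holds_entries s A ->
      exists (t : nat) (s' : state R),
        [/\ exec (no_subroutine R) P s t s',
            holds_output s' (box_simplex A b c eps) &
            t%:R <= C%:R * ((nnz A)%:R * (opnorm11 A * ln d%:R / eps))])
  /\
  (* running time, with access to A only through matrix-vector products *)
  (exists (P : cmd mv_name) (C : nat),
    forall (R : realType) (n d : nat) (A : 'M[R]_(n, d)) (b : 'cV[R]_d)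
      (c : 'cV[R]_n) (eps : R) (Tmv : mv_name -> nat) (s : state R),
      (1 < d)%N -> 0 < eps < opnorm11 A ->
      (maxn n d <= max_Tmv Tmv)%N ->
      holds_params s b c eps ->
      exists (t : nat) (s' : state R),
        [/\ exec (game_subroutines A Tmv) P s t s',
            holds_output s' (box_simplex A b c eps) &
            t%:R <= C%:R * ((max_Tmv Tmv)%:R * (opnorm11 A * ln d%:R / eps))]).
Proof.
split; [|split].
- by move=> R n [|d] // A b c eps _; exact: box_simplex_correct.
- exists (box_simplex_program entries_product), (62 * program_cost 49)%N.
  move=> R n [|d] // A b c eps s d1 he.
  rewrite geq_max => /andP[nM dM] hp [es [eu eP esz ev]].
  have ez : nnz A = size es.
    rewrite /nnz -(card_uniqP eu); apply: eq_card => ij.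
    by rewrite inE eP.
  have M1 : (0 < nnz A)%N by exact: leq_trans dM.
  have esM : (size es <= nnz A)%N by rewrite ez.
  have mN abs dst src (hd : is_rowvec dst) (hs : is_colvec src) :=
    entries_mulN M1 eu eP esz esM ev abs nM hd hs.
  have mD abs dst src (hd : is_colvec dst) (hs : is_rowvec src) :=
    entries_mulD M1 eu eP esz esM ev abs dM hd hs.
  have [t [s' [x o l]]] := box_simplex_program_correct he mN mD nM dM hp.
  by exists t, s'; split=> //; exact: time_bound l.
- exists (box_simplex_program (@MatVec mv_name)), (62 * program_cost 2)%N.
  move=> R n [|d] // A b c eps Tmv s d1 he.
  rewrite geq_max => /andP[nM dM] hp.
  have M1 : (0 < max_Tmv Tmv)%N by exact: leq_trans dM.
  have TM o : (Tmv o <= max_Tmv Tmv)%N.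
    by rewrite /max_Tmv; case: o; rewrite !leq_max leqnn ?orbT.
  have mN abs dst src (hd : is_rowvec dst) (hs : is_colvec src) :=
    subroutines_mulN A (s0 := s) M1 TM abs hd hs.
  have mD abs dst src (hd : is_colvec dst) (hs : is_rowvec src) :=
    subroutines_mulD A (s0 := s) M1 TM abs hd hs.
  have [t [s' [x o l]]] := box_simplex_program_correct he mN mD nM dM hp.
  by exists t, s'; split=> //; exact: time_bound l.
Qed.
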